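(* Let $A$ be a symmetric Frobenius superalgebra over the commutative ring $\Bbbk$ with trace map $\operatorname{tr}$ of parity $\varepsilon$, and let $n \in \mathbb{N}$. The $\Bbbk$-linear map $$\mathrm{Pol}_n(A) \otimes \mathrm{nilCox}_n(\Bbbk) \to \mathrm{nilHecke}_n(A),\qquad f \otimes z \mapsto fz,$$ is an isomorphism of $\Bbbk$-modules. Here, in the product $fz$, the elements $f$ and $z$ are viewed in $\mathrm{nilHecke}_n(A)$ via the natural algebra maps $\mathrm{Pol}_n(A) \to \mathrm{nilHecke}_n(A)$ and $\mathrm{nilCox}_n(\Bbbk) \to \mathrm{nilHecke}_n(A)$ sending $\mathbf{a} \in A^{\otimes n}$, $x_i$, and $u_j$ to the elements denoted by the same symbols.
   Context: All superalgebras are associative, unital and $\mathbb{Z}/2$-graded over a commutative ring $\Bbbk$; $\otimes=\otimes_\Bbbk$; $\bar a$ is the parity of a homogeneous $a$; equations involving parities are for homogeneous elements and extended linearly. Multiplication in $A\otimes B$ is $(a'\otimes b)(a\otimes b')=(-1)^{\bar a\bar b}a'a\otimes bb'$. A symmetric Frobenius superalgebra with trace of parity $\varepsilon\in\mathbb{Z}/2$ is a superalgebra $A$ with a homogeneous $\Bbbk$-linear map $\operatorname{tr}\colon A\to\Bbbk$ of parity $\varepsilon$ with $\operatorname{tr}(ab)=(-1)^{\bar a\bar b}\operatorname{tr}(ba)$, and such that $A$ has a (finite, homogeneous) $\Bbbk$-basis $\mathbf{B}_A$ with dual basis $\{b^\vee: b\in\mathbf{B}_A\}$ satisfying $\operatorname{tr}(a^\vee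 b)=\delta_{a,b}$ for $a,b\in\mathbf{B}_A$. Put $\tau=\sum_{b\in\mathbf{B}_A}(-1)^{\varepsilon\bar b}b\otimes b^\vee\in A^{\otimes 2}$ (independent of the basis, of parity $\varepsilon$), and $\tau_i=1^{\otimes(n-i-1)}\otimes\tau\otimes1^{\otimes(i-1)}\in A^{\otimes n}$. Tensor factors are numbered from right to left, elements being written $a_n\otimes\cdots\otimes a_1$. The symmetric group $\mathfrak{S}_n$ acts on $A^{\otimes n}$ by superpermutations: $s_i$ swaps the $i$-th and $(i+1)$-st factors with sign $(-1)^{\bar a_i\bar a_{i+1}}$. $\mathrm{nilHecke}_n(A)$ (the Frobenius nilHecke algebra) is the superalgebra generated by $A^{\otimes n}$ (as a superalgebra, i.e. take the free product of $A^{\otimes n}$ with the free superalgebra on the other generators), even generators $u_1,\dots,u_{n-1}$, and generators $x_1,\dots,x_n$ of parity $\varepsilon$, subject to: $u_i^2=0$; $u_iu_j=u_ju_i$ for $|i-j|>1$; $u_iu_{i+1}u_i=u_{i+1}u_iu_{i+1}$; $u_i\mathbf{a}=s_i(\mathbf{a})u_i$ for $\mathbf{a}\in A^{\otimes n}$; $x_ix_j=(-1)^\varepsilon x_jx_i$ for $i\ne j$; $\mathbf{a}x_i=(-1)^{\varepsilon\bar{\mathbf{a}}}x_i\mathbf{a}$; $x_ju_i=u_ix_j$ for $j\notin\{i,i+1\}$; $u_ix_{i+1}=x_iu_i+\tau_i$; $x_{i+1}u_i=u_ix_i+(-1)^\varepsilon\tau_i$. (This is the endomorphism algebra of the $n$-th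 tensor power of the generating object of the Frobenius nilHecke category.) $\mathrm{Pol}_n(A)$ (the Frobenius polynomial algebra) is the superalgebra generated by $A^{\otimes n}$ and $x_1,\dots,x_n$ of parity $\varepsilon$ subject to $x_ix_j=(-1)^\varepsilon x_jx_i$ ($i\neq j$) and $\mathbf{a}x_i=(-1)^{\varepsilon\bar{\mathbf{a}}}x_i\mathbf{a}$. $\mathrm{nilCox}_n(\Bbbk)$ is the usual nilCoxeter algebra: the $\Bbbk$-algebra generated by $u_1,\dots,u_{n-1}$ subject to $u_i^2=0$, $u_iu_j=u_ju_i$ for $|i-j|>1$, and $u_iu_{i+1}u_i=u_{i+1}u_iu_{i+1}$. *)

(* Defs.v *)
From HB Require Import structures.
From mathcomp Require Import all_boot all_order all_algebra.
From mathcomp Require Import boolp.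

Set Implicit Arguments.
Unset Strict Implicit.
Unset Printing Implicit Defensive.

Import GRing.Theory.
Local Open Scope ring_scope.
Local Open Scope quotient_scope.

(* MathComp's algType excludes the zero ring, but a presented algebra cannot be *)
(* assumed nonzero, and HB does not allow a new join of pzRingType and lmodType *)
(* below the existing ones.  Hence this record; its carrier alg_sort gets both  *)
(* the pzRingType and the lmodType k structures.                                *)
Record pzAlg (k : comPzRingType) := PzAlg {
  alg_mod : lmodType k;
  alg_one : alg_mod;
  alg_mul : alg_mod -> alg_mod -> alg_mod;
  alg_mulA : associative alg_mul;
  alg_mul1r : left_id alg_one alg_mul;
  alg_mulr1 : right_id alg_one alg_mul;
  alg_mulDl : left_distributive alg_mul +%R;
  alg_mulDr : right_distributive alg_mul +%R;
  alg_scaleAl : forall c x y, c *: alg_mul x y = alg_mul (c *: x) y;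
  alg_scaleAr : forall c x y, c *: alg_mul x y = alg_mul x (c *: y)
}.
Definition alg_sort (k : comPzRingType) (A : pzAlg k) : Type := alg_mod A.
Coercion alg_sort : pzAlg >-> Sortclass.

HB.instance Definition _ (k : comPzRingType) (A : pzAlg k) :=
  GRing.Lmodule.on (alg_sort A).
HB.instance Definition _ (k : comPzRingType) (A : pzAlg k) :=
  GRing.Zmodule_isPzRing.Build (alg_sort A) (@alg_mulA k A) (@alg_mul1r k A)
    (@alg_mulr1 k A) (@alg_mulDl k A) (@alg_mulDr k A).

(* so that a pzAlg can be passed where an lmodType k is expected *)
Coercion Defs_alg_sort__canonical__GRing_Lmodule : pzAlg >-> GRing.Lmodule.type.

Section AlgTheory.
Variables (k : comPzRingType) (A : pzAlg k).
Implicit Types (c : k) (x y : A).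

Lemma pzscalerAl c x y : c *: (x * y) = (c *: x) * y.
Proof. exact: alg_scaleAl. Qed.
Lemma pzscalerAr c x y : c *: (x * y) = x * (c *: y).
Proof. exact: alg_scaleAr. Qed.
End AlgTheory.

(* The grading A = A_0 (+) A_1 is given by the two complementary projections    *)
(* hpart p : A -> A_p; parities are booleans, added by addb.                    *)
Record superAlg (k : comPzRingType) := SuperAlg {
  super_alg :> pzAlg k;
  hpart : bool -> super_alg -> super_alg;
  hpart_linear : forall p, linear (hpart p);
  hpartK : forall p q a, hpart p (hpart q a) = if p == q then hpart q a else 0;
  hpart_sum : forall a, hpart false a + hpart true a = a;
  hpart1 : hpart false 1 = 1;
  hpartM : forall p q a b,
    hpart (p (+) q) (hpart p a * hpart q b) = hpart p a * hpart q b
}.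
Arguments hpart {k s}.

(* a \in A_p; note that 0 is homogeneous of both parities. *)
Definition homog (k : comPzRingType) (A : superAlg k) (p : bool) (a : A) : Prop :=
  hpart p a = a.

Section SuperTheory.
Variables (k : comPzRingType) (A : superAlg k).
Implicit Types (a b : A) (p q : bool).

HB.instance Definition _ p :=
  GRing.isLinear.Build k (alg_sort A) (alg_sort A) *:%R (@hpart k A p)
    (hpart_linear p).

Lemma homog_hpart p a : homog p (hpart p a).
Proof. by rewrite /homog hpartK eqxx. Qed.

Lemma homog0 p : homog p (0 : A).
Proof. by rewrite /homog linear0. Qed.

Lemma homogD p a b : homog p a -> homog p b -> homog p (a + b).
Proof. by move=> ha hb; rewrite /homog linearD /= ha hb. Qed.

Lemma homogZ p (c : k) a : homog p a -> homog p (c *: a).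
Proof. by move=> ha; rewrite /homog linearZ /= ha. Qed.

Lemma homog1 : homog false (1 : A).
Proof. exact: hpart1. Qed.

Lemma homogM p q a b : homog p a -> homog q b -> homog (p (+) q) (a * b).
Proof. by rewrite /homog => <- <-; rewrite hpartM. Qed.

Lemma hpart_homog p q a : homog q a -> hpart p a = if p == q then a else 0.
Proof. by move=> ha; rewrite -{1}ha hpartK ha. Qed.

End SuperTheory.

Section Base.
Variable k : comPzRingType.

Lemma base_scaleAl (c x y : k^o) : c *: (x * y : k^o) = ((c *: x) * y).
Proof. exact: mulrA. Qed.
Lemma base_scaleAr (c x y : k^o) : c *: (x * y : k^o) = x * (c *: y).
Proof. exact: mulrCA. Qed.

Definition base_alg : pzAlg k :=
  @PzAlg k k^o 1 *%R (@mulrA k) (@mul1r k) (@mulr1 k) (@mulrDl k) (@mulrDr k)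
    base_scaleAl base_scaleAr.

Definition base_hpart (p : bool) (a : base_alg) : base_alg := if p then 0 else a.
Lemma base_hpart_linear p : linear (base_hpart p).
Proof. by case: p => // c x y; rewrite /base_hpart scaler0 addr0. Qed.
Lemma base_hpartK p q a :
  base_hpart p (base_hpart q a) = if p == q then base_hpart q a else 0.
Proof. by case: p; case: q. Qed.
Lemma base_hpart_sum a : base_hpart false a + base_hpart true a = a.
Proof. exact: addr0. Qed.
Lemma base_hpart1 : base_hpart false 1 = 1. Proof. by []. Qed.
Lemma base_hpartM p q a b :
  base_hpart (p (+) q) (base_hpart p a * base_hpart q b)
  = base_hpart p a * base_hpart q b.
Proof. by case: p; case: q; rewrite /= ?mul0r ?mulr0. Qed.

(* k itself, concentrated in even degree *)
Definition base_super : superAlg k :=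
  SuperAlg base_hpart_linear base_hpartK base_hpart_sum base_hpart1 base_hpartM.
End Base.

(* M (x)_k N is the quotient of the formal linear expressions in symbols       *)
(* m (x) n by the congruence generated by the module axioms and bilinearity.   *)
Inductive texpr (k M N : Type) : Type :=
| TZero
| TPure of M & N
| TAdd of texpr k M N & texpr k M N
| TOpp of texpr k M N
| TScale of k & texpr k M N.
Arguments TZero {k M N}.
Arguments TPure {k M N}.

Section TensorModule.
Variables (k : comPzRingType) (M N : lmodType k).

Inductive teq : texpr k M N -> texpr k M N -> Prop :=
| teq_refl s : teq s s
| teq_sym s t : teq s t -> teq t s
| teq_trans s t u : teq s t -> teq t u -> teq s u
| teq_Add s s' t t' : teq s s' -> teq t t' -> teq (TAdd s t) (TAdd s' t')
| teq_Opp s s' : teq s s' -> teq (TOpp s) (TOpp s')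
| teq_Scale c s s' : teq s s' -> teq (TScale c s) (TScale c s')
| teq_addA s t u : teq (TAdd s (TAdd t u)) (TAdd (TAdd s t) u)
| teq_addC s t : teq (TAdd s t) (TAdd t s)
| teq_add0 s : teq (TAdd TZero s) s
| teq_addN s : teq (TAdd (TOpp s) s) TZero
| teq_scaleA c d s : teq (TScale c (TScale d s)) (TScale (c * d) s)
| teq_scale1 s : teq (TScale 1 s) s
| teq_scaleDr c s t : teq (TScale c (TAdd s t)) (TAdd (TScale c s) (TScale c t))
| teq_scaleDl c d s : teq (TScale (c + d) s) (TAdd (TScale c s) (TScale d s))
| teq_pureDl m m' n : teq (TPure (m + m') n) (TAdd (TPure m n) (TPure m' n))
| teq_pureDr m n n' : teq (TPure m (n + n')) (TAdd (TPure m n) (TPure m n'))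
| teq_pureZl c m n : teq (TPure (c *: m) n) (TScale c (TPure m n))
| teq_pureZr c m n : teq (TPure m (c *: n)) (TScale c (TPure m n)).

Definition teqb (s t : {classic texpr k M N}) : bool := `[< teq s t >].

Lemma teqb_refl : reflexive teqb.
Proof. by move=> s; apply/asboolP; exact: teq_refl. Qed.
Lemma teqb_sym : symmetric teqb.
Proof. by move=> s t; apply/asboolP/asboolP; exact: teq_sym. Qed.
Lemma teqb_trans : transitive teqb.
Proof.
by move=> t s u /asboolP st /asboolP tu; apply/asboolP; exact: teq_trans tu.
Qed.
Canonical teqb_equiv := EquivRel teqb teqb_refl teqb_sym teqb_trans.

Definition tens : Type := {eq_quot teqb_equiv}.
HB.instance Definition _ := Choice.on tens.
HB.instance Definition _ := EqQuotient.on tens.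

Definition tclass (s : texpr k M N) : tens := \pi_tens (s : {classic texpr k M N}).

Lemma tclassP s t : tclass s = tclass t <-> teq s t.
Proof.
split; first by move/eqmodP/asboolP.
by move=> st; apply/eqmodP/asboolP.
Qed.

Lemma tclass_repr x : tclass (repr x) = x.
Proof. exact: reprK. Qed.

Lemma tens_quotP (P : tens -> Prop) : (forall s, P (tclass s)) -> forall x, P x.
Proof. by move=> H x; rewrite -(tclass_repr x); exact: H. Qed.

Lemma teq_repr s : teq (repr (tclass s)) s.
Proof. by apply/tclassP; rewrite tclass_repr. Qed.

Definition tzero : tens := tclass TZero.
Definition tadd (x y : tens) : tens := tclass (TAdd (repr x) (repr y)).
Definition topp (x : tens) : tens := tclass (TOpp (repr x)).
Definition tscale (c : k) (x : tens) : tens := tclass (TScale c (repr x)).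

Lemma taddE s t : tadd (tclass s) (tclass t) = tclass (TAdd s t).
Proof. by apply/tclassP; apply: teq_Add; exact: teq_repr. Qed.
Lemma toppE s : topp (tclass s) = tclass (TOpp s).
Proof. by apply/tclassP; apply: teq_Opp; exact: teq_repr. Qed.
Lemma tscaleE c s : tscale c (tclass s) = tclass (TScale c s).
Proof. by apply/tclassP; apply: teq_Scale; exact: teq_repr. Qed.

Lemma taddA : associative tadd.
Proof.
elim/tens_quotP=> s; elim/tens_quotP=> t; elim/tens_quotP=> u.
by rewrite !taddE; apply/tclassP; exact: teq_addA.
Qed.
Lemma taddC : commutative tadd.
Proof.
elim/tens_quotP=> s; elim/tens_quotP=> t.
by rewrite !taddE; apply/tclassP; exact: teq_addC.
Qed.
Lemma tadd0 : left_id tzero tadd.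
Proof. by elim/tens_quotP=> s; rewrite taddE; apply/tclassP; exact: teq_add0. Qed.
Lemma taddN : left_inverse tzero topp tadd.
Proof.
by elim/tens_quotP=> s; rewrite toppE taddE; apply/tclassP; exact: teq_addN.
Qed.
HB.instance Definition _ := GRing.isZmodule.Build tens taddA taddC tadd0 taddN.

Lemma tscaleA c d x : tscale c (tscale d x) = tscale (c * d) x.
Proof.
by elim/tens_quotP: x => s; rewrite !tscaleE; apply/tclassP; exact: teq_scaleA.
Qed.
Lemma tscale1 : left_id 1 tscale.
Proof. by elim/tens_quotP=> s; rewrite tscaleE; apply/tclassP; exact: teq_scale1. Qed.
Lemma tscaleDr : right_distributive tscale +%R.
Proof.
move=> c; elim/tens_quotP=> s; elim/tens_quotP=> t.
rewrite [in LHS]/GRing.add/= [in RHS]/GRing.add/= taddE !tscaleE taddE.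
by apply/tclassP; exact: teq_scaleDr.
Qed.
Lemma tscaleDl x : {morph tscale^~ x : c d / c + d}.
Proof.
move=> c d; elim/tens_quotP: x => s.
rewrite [X in _ = X]/GRing.add/= !tscaleE taddE.
by apply/tclassP; exact: teq_scaleDl.
Qed.
HB.instance Definition _ :=
  GRing.Zmodule_isLmodule.Build k tens tscaleA tscale1 tscaleDr tscaleDl.

Definition pure (m : M) (n : N) : tens := tclass (TPure m n).

Definition bilinear_map (V : lmodType k) (f : M -> N -> V) : Prop :=
  (forall n, linear (f^~ n)) /\ (forall m, linear (f m)).

Lemma tclassD s t : tclass (TAdd s t) = tclass s + tclass t.
Proof. by rewrite [RHS]/GRing.add /= taddE. Qed.
Lemma tclassN s : tclass (TOpp s) = - tclass s.
Proof. by rewrite [RHS]/GRing.opp /= toppE. Qed.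
Lemma tclassZ c s : tclass (TScale c s) = c *: tclass s.
Proof. by rewrite [RHS]/GRing.scale /= tscaleE. Qed.

Lemma pureDl m m' n : pure (m + m') n = pure m n + pure m' n.
Proof. by rewrite -tclassD; apply/tclassP; exact: teq_pureDl. Qed.
Lemma pureDr m n n' : pure m (n + n') = pure m n + pure m n'.
Proof. by rewrite -tclassD; apply/tclassP; exact: teq_pureDr. Qed.
Lemma pureZl c m n : pure (c *: m) n = c *: pure m n.
Proof. by rewrite -tclassZ; apply/tclassP; exact: teq_pureZl. Qed.
Lemma pureZr c m n : pure m (c *: n) = c *: pure m n.
Proof. by rewrite -tclassZ; apply/tclassP; exact: teq_pureZr. Qed.

Lemma pure0l n : pure 0 n = 0.
Proof. by rewrite -(scale0r (0 : M)) pureZl scale0r. Qed.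
Lemma pure0r m : pure m 0 = 0.
Proof. by rewrite -(scale0r (0 : N)) pureZr scale0r. Qed.

Lemma pure_bilinear : bilinear_map pure.
Proof.
by split=> [n c m m'|m c n n']; rewrite ?pureDl ?pureZl ?pureDr ?pureZr.
Qed.

Lemma tens_ind (P : tens -> Prop) :
  P 0 -> (forall x y, P x -> P y -> P (x + y)) -> (forall m n, P (pure m n)) ->
  forall x, P x.
Proof.
move=> P0 PD Pp; suff H s c : P (c *: tclass s).
  by elim/tens_quotP=> s; rewrite -[tclass s]scale1r; exact: H.
elim: s c => [|m n|s IHs t IHt|s IHs|d s IHs] c.
- by rewrite (_ : tclass TZero = 0) // scaler0.
- by rewrite -/(pure m n) -pureZl.
- by rewrite tclassD scalerDr; exact: PD.
- by rewrite tclassN scalerN -scaleNr.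
- by rewrite tclassZ scalerA.
Qed.

Section Lift.
Variables (V : lmodType k) (f : M -> N -> V).

Fixpoint teval (s : texpr k M N) : V :=
  match s with
  | TZero => 0
  | TPure m n => f m n
  | TAdd s t => teval s + teval t
  | TOpp s => - teval s
  | TScale c s => c *: teval s
  end.

(* The universal property; only meaningful when f is bilinear. *)
Definition tens_lift (x : tens) : V := teval (repr x).

Hypothesis f_bilin : bilinear_map f.

Lemma teval_teq s t : teq s t -> teval s = teval t.
Proof.
case: f_bilin => fl fr.
have fZl c m n : f (c *: m) n = c *: f m n.
  have f0 : f 0 n = 0.
    by have := fl n (-1) 0 0; rewrite /= scaler0 addr0 scaleN1r addNr.
  by have := fl n c m 0; rewrite /= f0 !addr0.
have fZr c m n : f m (c *: n) = c *: f m n.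
  have f0 : f m 0 = 0.
    by have := fr m (-1) 0 0; rewrite /= scaler0 addr0 scaleN1r addNr.
  by have := fr m c n 0; rewrite /= f0 !addr0.
elim=> {s t} //=.
- by move=> s t u _ -> _ ->.
- by move=> s s' t t' _ -> _ ->.
- by move=> s s' _ ->.
- by move=> c s s' _ ->.
- by move=> s t u; rewrite addrA.
- by move=> s t; rewrite addrC.
- by move=> s; rewrite add0r.
- by move=> s; rewrite addNr.
- by move=> c d s; rewrite scalerA.
- by move=> s; rewrite scale1r.
- by move=> c s t; rewrite scalerDr.
- by move=> c d s; rewrite scalerDl.
- by move=> m m' n; have := fl n 1 m m'; rewrite /= !scale1r.
- by move=> m n n'; have := fr m 1 n n'; rewrite /= !scale1r.
Qed.

Lemma tens_lift_class s : tens_lift (tclass s) = teval s.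
Proof. by apply: teval_teq; exact: teq_repr. Qed.

Lemma tens_liftE m n : tens_lift (pure m n) = f m n.
Proof. exact: tens_lift_class. Qed.

Lemma tens_lift_linear : linear tens_lift.
Proof.
move=> c; elim/tens_quotP=> s; elim/tens_quotP=> t.
by rewrite -tclassZ -tclassD !tens_lift_class.
Qed.
End Lift.

Lemma tens_ext (V : lmodType k) (g h : tens -> V) : linear g -> linear h ->
  (forall m n, g (pure m n) = h (pure m n)) -> g =1 h.
Proof.
move=> gl hl gh x.
pose G := HB.pack g (GRing.isLinear.Build k tens V *:%R g gl) : {linear tens -> V}.
pose H := HB.pack h (GRing.isLinear.Build k tens V *:%R h hl) : {linear tens -> V}.
rewrite -[g]/(G : _ -> _) -[h]/(H : _ -> _).
elim/tens_ind: x => [|x y|m n].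
- by rewrite !linear0.
- by rewrite !linearD => -> ->.
- exact: gh.
Qed.
End TensorModule.

Section Bilinear.
Variables (k : comPzRingType) (M N V : lmodType k).
Implicit Types f : M -> N -> V.

Lemma bilin_sum (I : finType) (F : I -> M -> N -> V) :
  (forall i, bilinear_map (F i)) -> bilinear_map (fun m n => \sum_i F i m n).
Proof.
move=> FB; split=> [n c m m'|m c n n'].
- rewrite scaler_sumr -big_split; apply: eq_bigr => i _.
  exact: (proj1 (FB i)).
- rewrite scaler_sumr -big_split; apply: eq_bigr => i _.
  exact: (proj2 (FB i)).
Qed.

Lemma bilin_scale (d : k) f : bilinear_map f -> bilinear_map (fun m n => d *: f m n).
Proof.
move=> [fl fr]; split=> [n c m m'|m c n n'].
- by rewrite (fl n) scalerDr !scalerA mulrC.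
- by rewrite (fr m) scalerDr !scalerA mulrC.
Qed.

Lemma bilin_comp (M' N' : lmodType k) (g : M' -> M) (h : N' -> N) f :
  bilinear_map f -> linear g -> linear h ->
  bilinear_map (fun m n => f (g m) (h n)).
Proof.
move=> [fl fr] gl hl; split=> [n c m m'|m c n n'].
- by rewrite gl; exact: fl.
- by rewrite hl; exact: fr.
Qed.
End Bilinear.

Section TensorMap.
Variables (k : comPzRingType) (M N M' N' : lmodType k).
Implicit Types (f : M -> M') (g : N -> N').

Definition tens_map f g : tens M N -> tens M' N' :=
  tens_lift (fun m n => pure (f m) (g n)).

Lemma tens_map_bilinear f g : linear f -> linear g ->
  bilinear_map (fun m n => pure (f m) (g n)).
Proof. by move=> fl gl; apply: bilin_comp fl gl; exact: pure_bilinear. Qed.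

Lemma tens_mapE f g m n : linear f -> linear g ->
  tens_map f g (pure m n) = pure (f m) (g n).
Proof. by move=> fl gl; rewrite /tens_map tens_liftE //; exact: tens_map_bilinear. Qed.

Lemma tens_map_linear f g : linear f -> linear g -> linear (tens_map f g).
Proof. by move=> fl gl; apply: tens_lift_linear; exact: tens_map_bilinear. Qed.
End TensorMap.

(* the sign (-1)^p *)
Definition psign (k : comPzRingType) (p : bool) : k := (-1) ^+ p.
Arguments psign {k}.

Section Sign.
Variable k : comPzRingType.
Lemma psignD p q : psign (p (+) q) = psign p * psign q :> k.
Proof. by rewrite /psign signr_addb. Qed.
Lemma psignK p : psign p * psign p = 1 :> k.
Proof. by rewrite -psignD addbb. Qed.
End Sign.

Section TensorSuper.
Variables (k : comPzRingType) (A B : superAlg k).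
Local Notation AB := (tens A B).

Lemma mull_linear (C : pzAlg k) (a : C) : linear (fun x : C => a * x : C).
Proof. by move=> c x y; rewrite mulrDr -pzscalerAr. Qed.
Lemma mulr_linear (C : pzAlg k) (a : C) : linear (fun x : C => x * a : C).
Proof. by move=> c x y; rewrite mulrDl -pzscalerAl. Qed.

Lemma tens_homog_ind (P : AB -> Prop) :
  P 0 -> (forall x y, P x -> P y -> P (x + y)) ->
  (forall p q (a : A) (b : B), homog p a -> homog q b -> P (pure a b)) ->
  forall x, P x.
Proof.
move=> P0 PD Pp; apply: tens_ind => // a b.
rewrite -(hpart_sum a) -(hpart_sum b) pureDl !pureDr.
by apply: (PD); apply: (PD); apply: Pp; exact: homog_hpart.
Qed.

(* (a' (x) b)(a (x) b') = (-1)^{|a||b|} a'a (x) bb', extended to               *)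
(* nonhomogeneous elements by splitting a and b into homogeneous parts.        *)
Definition tmul_pure (a' : A) (b : B) (a : A) (b' : B) : AB :=
  \sum_(p : bool) \sum_(q : bool)
    psign (p && q) *: pure (a' * hpart q a) (hpart p b * b').

Definition tmul (x y : AB) : AB :=
  tens_lift (fun a' b => tens_lift (tmul_pure a' b) y) x.

Definition tone : AB := pure (1 : A) (1 : B).

Definition thpart (r : bool) : AB -> AB :=
  tens_lift (fun a b => \sum_(p : bool) pure (hpart p a) (hpart (r (+) p) b)).

Lemma tmul_pure_bilinear a' b : bilinear_map (tmul_pure a' b).
Proof.
apply: bilin_sum => p; apply: bilin_sum => q; apply: bilin_scale.
apply: (@bilin_comp _ _ _ _ _ _ (fun a : A => a' * hpart q a : A)
   (fun b' : B => hpart p b * b' : B) _ (pure_bilinear A B)).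
- by move=> c x y; rewrite linearP mulrDr -pzscalerAr.
- exact: mull_linear.
Qed.

Lemma tmul_pure_bilinear2 a b' : bilinear_map (fun a' b => tmul_pure a' b a b').
Proof.
apply: bilin_sum => p; apply: bilin_sum => q; apply: bilin_scale.
apply: (@bilin_comp _ _ _ _ _ _ (fun a' : A => a' * hpart q a : A)
   (fun b : B => hpart p b * b' : B) _ (pure_bilinear A B)).
- exact: mulr_linear.
- by move=> c x y; rewrite linearP mulrDl -pzscalerAl.
Qed.

Lemma tmul_bilinear1 y : bilinear_map (fun a' b => tens_lift (tmul_pure a' b) y).
Proof.
elim/tens_ind: y => [|x y IHx IHy|a b'].
- have H a b : tens_lift (tmul_pure a b) 0 = 0.
    have := tens_lift_linear (tmul_pure_bilinear a b) (-1) 0 0.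
    by rewrite scaler0 addr0 scaleN1r addNr.
  by split=> [n c m m'|m c n n']; rewrite !H scaler0 addr0.
- have H a b : tens_lift (tmul_pure a b) (x + y)
     = tens_lift (tmul_pure a b) x + tens_lift (tmul_pure a b) y.
    have := tens_lift_linear (tmul_pure_bilinear a b) 1 x y.
    by rewrite !scale1r.
  split=> [n c m m'|m c n n']; rewrite !H.
  + by rewrite (proj1 IHx) (proj1 IHy) scalerDr addrACA.
  + by rewrite (proj2 IHx) (proj2 IHy) scalerDr addrACA.
- have [Hl Hr] := tmul_pure_bilinear2 a b'.
  by split=> [n c m m'|m c n n']; rewrite !tens_liftE //;
     try exact: tmul_pure_bilinear; [exact: Hl | exact: Hr].
Qed.

Lemma tmul_linearl y : linear (tmul^~ y).
Proof. exact: tens_lift_linear (tmul_bilinear1 y). Qed.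

Lemma tmul_linearr x : linear (tmul x).
Proof.
elim/tens_ind: x => [|x y IHx IHy|a b].
- have H y : tmul 0 y = 0.
    have := tmul_linearl y (-1) 0 0.
    by rewrite /= scaler0 addr0 scaleN1r addNr.
  by move=> c u v; rewrite !H scaler0 addr0.
- have H z : tmul (x + y) z = tmul x z + tmul y z.
    by have := tmul_linearl z 1 x y; rewrite /= !scale1r.
  by move=> c u v; rewrite !H IHx IHy scalerDr addrACA.
- move=> c u v; rewrite /tmul !tens_liftE; try exact: tmul_bilinear1.
  exact: (tens_lift_linear (tmul_pure_bilinear a b)).
Qed.

Lemma tmulE p q (a' : A) (b : B) (a : A) (b' : B) : homog p b -> homog q a ->
  tmul (pure a' b) (pure a b') = psign (p && q) *: pure (a' * a) (b * b').
Proof.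
move=> hb ha; rewrite /tmul tens_liftE; last exact: tmul_bilinear1.
rewrite tens_liftE; last exact: tmul_pure_bilinear.
rewrite /tmul_pure !big_bool /= !(hpart_homog _ ha) !(hpart_homog _ hb).
by case: p hb => _; case: q ha => _ /=;
  rewrite ?(mul0r, mulr0, pure0l, pure0r, scaler0, addr0, add0r).
Qed.

Lemma tmulDl : left_distributive tmul +%R.
Proof. by move=> x y z; have := tmul_linearl z 1 x y; rewrite /= !scale1r. Qed.
Lemma tmulDr : right_distributive tmul +%R.
Proof. by move=> x y z; have := tmul_linearr x 1 y z; rewrite /= !scale1r. Qed.
Lemma tmul0l y : tmul 0 y = 0.
Proof. by apply: (addrI (tmul 0 y)); rewrite -tmulDl !addr0. Qed.
Lemma tmul0r x : tmul x 0 = 0.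
Proof. by apply: (addrI (tmul x 0)); rewrite -tmulDr !addr0. Qed.
Lemma tmulZl c x y : c *: tmul x y = tmul (c *: x) y.
Proof. by have := tmul_linearl y c x 0; rewrite /= tmul0l !addr0. Qed.
Lemma tmulZr c x y : c *: tmul x y = tmul x (c *: y).
Proof. by have := tmul_linearr x c y 0; rewrite /= tmul0r !addr0. Qed.

Lemma tmulA : associative tmul.
Proof.
move=> x y z.
elim/tens_homog_ind: x => [|x1 x2 IH1 IH2|p1 q1 a1 b1 ha1 hb1].
- by rewrite !tmul0l.
- by rewrite !tmulDl IH1 IH2.
elim/tens_homog_ind: y => [|x1 x2 IH1 IH2|p2 q2 a2 b2 ha2 hb2].
- by rewrite !(tmul0l, tmul0r).
- by rewrite !(tmulDl, tmulDr) IH1 IH2.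
elim/tens_homog_ind: z => [|x1 x2 IH1 IH2|p3 q3 a3 b3 ha3 hb3].
- by rewrite !tmul0r.
- by rewrite !tmulDr IH1 IH2.
rewrite (tmulE _ _ hb2 ha3) (tmulE _ _ hb1 ha2) -tmulZl -tmulZr.
rewrite (tmulE _ _ hb1 (homogM ha2 ha3)) (tmulE _ _ (homogM hb1 hb2) ha3).
rewrite !scalerA !mulrA -!psignD; congr (psign _ *: _).
by case: q1 q2 p2 p3 {ha1 ha2 ha3 hb1 hb2 hb3} => [] [] [] [].
Qed.

Lemma tmul1 : left_id tone tmul.
Proof.
elim/tens_homog_ind => [|x y IHx IHy|p q a b ha hb].
- exact: tmul0r.
- by rewrite tmulDr IHx IHy.
- by rewrite (tmulE _ _ (homog1 B) ha) scale1r !mul1r.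
Qed.

Lemma t1mul : right_id tone tmul.
Proof.
elim/tens_homog_ind => [|x y IHx IHy|p q a b ha hb].
- exact: tmul0l.
- by rewrite tmulDl IHx IHy.
- by rewrite (tmulE _ _ hb (homog1 A)) andbF scale1r !mulr1.
Qed.

Definition tens_alg : pzAlg k :=
  PzAlg tmulA tmul1 t1mul tmulDl tmulDr tmulZl tmulZr.

Lemma thpart_bilinear r :
  bilinear_map (fun (a : A) (b : B) =>
    \sum_(p : bool) pure (hpart p a) (hpart (r (+) p) b)).
Proof.
apply: bilin_sum => p.
apply: (@bilin_comp _ _ _ _ _ _ (@hpart k A p) (@hpart k B (r (+) p)) _
  (pure_bilinear A B)); exact: hpart_linear.
Qed.

Lemma thpart_linear r : linear (thpart r).
Proof. exact: tens_lift_linear (thpart_bilinear r). Qed.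
Lemma thpart0 r : thpart r 0 = 0.
Proof. by have := thpart_linear r (-1) 0 0; rewrite scaler0 addr0 scaleN1r addNr. Qed.
Lemma thpartD r x y : thpart r (x + y) = thpart r x + thpart r y.
Proof. by have := thpart_linear r 1 x y; rewrite !scale1r. Qed.
Lemma thpartZ r c x : thpart r (c *: x) = c *: thpart r x.
Proof. by have := thpart_linear r c x 0; rewrite thpart0 !addr0. Qed.

Lemma thpartE r p q (a : A) (b : B) : homog p a -> homog q b ->
  thpart r (pure a b) = if r == p (+) q then pure a b else 0.
Proof.
move=> ha hb; rewrite /thpart tens_liftE; last exact: thpart_bilinear.
rewrite !big_bool !(hpart_homog _ ha) !(hpart_homog _ hb).
by case: r; case: p ha => _; case: q hb => _ /=;
  rewrite ?(pure0l, pure0r, addr0, add0r).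
Qed.

Lemma thpartK r s x :
  thpart r (thpart s x) = if r == s then thpart s x else 0.
Proof.
elim/tens_homog_ind: x => [|x y IHx IHy|p q a b ha hb].
- by rewrite !thpart0; case: ifP.
- by rewrite !thpartD IHx IHy; case: ifP => // _; rewrite addr0.
- rewrite (thpartE _ ha hb); case: ifP => [/eqP->|_].
    by rewrite (thpartE _ ha hb).
  by rewrite thpart0; case: ifP.
Qed.

Lemma thpart_sum x : thpart false x + thpart true x = x.
Proof.
elim/tens_homog_ind: x => [|x y IHx IHy|p q a b ha hb].
- by rewrite !thpart0 addr0.
- by rewrite !thpartD addrACA IHx IHy.
- by rewrite !(thpartE _ ha hb); case: (p (+) q); rewrite /= (addr0, add0r).
Qed.

Lemma thpart1 : thpart false tone = tone.
Proof. by rewrite (thpartE _ (homog1 A) (homog1 B)). Qed.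

Lemma thpartM r s x y :
  thpart (r (+) s) (tmul (thpart r x) (thpart s y))
  = tmul (thpart r x) (thpart s y).
Proof.
elim/tens_homog_ind: x => [|x1 x2 IH1 IH2|p1 q1 a1 b1 ha1 hb1].
- by rewrite !(thpart0, tmul0l).
- by rewrite !(thpartD, tmulDl) IH1 IH2.
elim/tens_homog_ind: y => [|x1 x2 IH1 IH2|p2 q2 a2 b2 ha2 hb2].
- by rewrite !(thpart0, tmul0r).
- by rewrite !(thpartD, tmulDr) IH1 IH2.
rewrite (thpartE _ ha1 hb1) (thpartE _ ha2 hb2).
case: (r =P _) => [->|_]; last by rewrite !(thpart0, tmul0l).
case: (s =P _) => [->|_]; last by rewrite !(thpart0, tmul0r).
rewrite (tmulE _ _ hb1 ha2) thpartZ (thpartE _ (homogM ha1 ha2) (homogM hb1 hb2)).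
by rewrite addbACA eqxx.
Qed.

Definition tens_super : superAlg k :=
  @SuperAlg k tens_alg thpart thpart_linear thpartK thpart_sum thpart1 thpartM.
End TensorSuper.

(* A^{(x) n}, with elements written a_{n-1} (x) ... (x) a_0: the tensor        *)
(* factors are numbered from right to left and, here, from 0.                  *)
Fixpoint tpow (k : comPzRingType) (A : superAlg k) (n : nat) : superAlg k :=
  if n is n'.+1 then tens_super A (tpow A n') else base_super k.

Section TensorPower.
Variables (k : comPzRingType) (A : superAlg k).

(* a_{n-1} (x) ... (x) a_0 *)
Fixpoint pure_tpow (n : nat) (a : nat -> A) : tpow A n :=
  if n is n'.+1 then pure (a n') (pure_tpow n' a) else 1.

(* b (x) (a (x) t) |-> (-1)^{|a||b|} a (x) (b (x) t) *)
Definition tswap_pure (T : superAlg k) (b a : A) (t : T) : tens A (tens A T) :=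
  \sum_(p : bool) \sum_(q : bool)
    psign (p && q) *: pure (hpart p a) (pure (hpart q b) t).
Definition tswap (T : superAlg k) : tens A (tens A T) -> tens A (tens A T) :=
  tens_lift (fun b => tens_lift (tswap_pure b)).

(* the exchange of the two leftmost factors *)
Definition swap_top (n : nat) : tpow A n.+1 -> tpow A n.+1 :=
  if n is n'.+1 then @tswap (tpow A n') else id.

(* The superpermutation exchanging the factors i and i+1 (see superperm_pure), *)
(* for i + 1 < n.                                                              *)
Fixpoint superperm (i n : nat) : tpow A n -> tpow A n :=
  if n is n'.+1 then
    if i.+1 == n' then @swap_top n' else tens_map id (@superperm i n')
  else id.

Lemma eq_pure_tpow n (a a' : nat -> A) :
  (forall j, (j < n)%N -> a j = a' j) -> pure_tpow n a = pure_tpow n a'.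
Proof.
elim: n => //= n IHn aa'; rewrite (aa' n) // IHn // => j jn.
by apply: aa'; exact: ltnW.
Qed.

Section Swap.
Variable T : superAlg k.

Lemma tswap_pure_bilinear b : bilinear_map (@tswap_pure T b).
Proof.
apply: bilin_sum => p; apply: bilin_sum => q; apply: bilin_scale.
apply: (@bilin_comp _ _ _ _ _ _ (@hpart k A p)
  (fun t : T => pure (hpart q b) t) _ (pure_bilinear _ _)).
- exact: hpart_linear.
- exact: (proj2 (pure_bilinear A T)).
Qed.

Lemma tswap_bilinear : bilinear_map (fun b => tens_lift (@tswap_pure T b)).
Proof.
split=> [x c b b'|b]; last exact: tens_lift_linear (tswap_pure_bilinear b).
elim/tens_ind: x => [|x y IHx IHy|a t].
- have H d : tens_lift (@tswap_pure T d) 0 = 0.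
    have := tens_lift_linear (tswap_pure_bilinear d) (-1) 0 0.
    by rewrite scaler0 addr0 scaleN1r addNr.
  by rewrite !H scaler0 addr0.
- have H d : tens_lift (@tswap_pure T d) (x + y)
     = tens_lift (@tswap_pure T d) x + tens_lift (@tswap_pure T d) y.
    have := tens_lift_linear (tswap_pure_bilinear d) 1 x y.
    by rewrite !scale1r.
  by rewrite !H IHx IHy scalerDr addrACA.
- rewrite !tens_liftE; try exact: tswap_pure_bilinear.
  rewrite /tswap_pure scaler_sumr -big_split; apply: eq_bigr => p _.
  rewrite scaler_sumr -big_split; apply: eq_bigr => q _.
  rewrite /= linearP /= pureDl pureZl pureDr pureZr scalerDr !scalerA.
  by rewrite mulrC.
Qed.

Lemma tswap_linear : linear (@tswap T).
Proof. exact: tens_lift_linear tswap_bilinear. Qed.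

Lemma tswapE p q (b a : A) (t : T) : homog p b -> homog q a ->
  tswap (pure b (pure a t)) = psign (p && q) *: pure a (pure b t).
Proof.
move=> hb ha; rewrite /tswap tens_liftE; last exact: tswap_bilinear.
rewrite tens_liftE; last exact: tswap_pure_bilinear.
rewrite /tswap_pure !big_bool /= !(hpart_homog _ ha) !(hpart_homog _ hb).
by case: p hb => _; case: q ha => _ /=;
  rewrite ?(pure0l, pure0r, scaler0, addr0, add0r).
Qed.
End Swap.

Lemma superperm_linear i n : linear (@superperm i n).
Proof.
elim: n => [|n IHn] //=; case: eqP => [_|_].
- by case: n {IHn} => [|n] //=; exact: tswap_linear.
- exact: tens_map_linear.
Qed.

Lemma superperm_pure i n (a : nat -> A) (par : nat -> bool) :
  (forall j, homog (par j) (a j)) -> (i.+1 < n)%N ->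
  superperm i (pure_tpow n a)
  = psign (par i && par i.+1) *:
      pure_tpow n (fun j => if j == i then a i.+1
                            else if j == i.+1 then a i else a j).
Proof.
move=> ha; elim: n => // n IHn; rewrite ltnS leq_eqVlt /=.
case: eqP => [<- _|ni /= lt_in].
  rewrite /= (tswapE _ (ha i.+1) (ha i)) andbC !eqxx.
  rewrite (gtn_eqF (ltnSn i)); congr (_ *: pure _ (pure _ _)).
  by apply: eq_pure_tpow => j ji; rewrite !ltn_eqF // ltnW.
rewrite tens_mapE //; last exact: superperm_linear.
rewrite IHn // pureZr /= (gtn_eqF (ltnW lt_in)).
by have /negbTE-> : n != i.+1 by apply/eqP=> /esym.
Qed.
End TensorPower.

(* The k-algebra presented by generators G and relations R: formal algebra     *)
(* expressions in G modulo the congruence generated by the k-algebra axioms    *)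
(* and R.                                                                      *)
Inductive aexpr (k G : Type) : Type :=
| AZero
| AOne
| AGen of G
| AAdd of aexpr k G & aexpr k G
| AOpp of aexpr k G
| AScale of k & aexpr k G
| AMul of aexpr k G & aexpr k G.
Arguments AZero {k G}.
Arguments AOne {k G}.
Arguments AGen {k G}.

Section Presentation.
Variables (k : comPzRingType) (G : Type) (R : aexpr k G -> aexpr k G -> Prop).

Inductive aeq : aexpr k G -> aexpr k G -> Prop :=
| aeq_rel s t : R s t -> aeq s t
| aeq_refl s : aeq s s
| aeq_sym s t : aeq s t -> aeq t s
| aeq_trans s t u : aeq s t -> aeq t u -> aeq s u
| aeq_Add s s' t t' : aeq s s' -> aeq t t' -> aeq (AAdd s t) (AAdd s' t')
| aeq_Opp s s' : aeq s s' -> aeq (AOpp s) (AOpp s')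
| aeq_Scale c s s' : aeq s s' -> aeq (AScale c s) (AScale c s')
| aeq_Mul s s' t t' : aeq s s' -> aeq t t' -> aeq (AMul s t) (AMul s' t')
| aeq_addA s t u : aeq (AAdd s (AAdd t u)) (AAdd (AAdd s t) u)
| aeq_addC s t : aeq (AAdd s t) (AAdd t s)
| aeq_add0 s : aeq (AAdd AZero s) s
| aeq_addN s : aeq (AAdd (AOpp s) s) AZero
| aeq_scaleA c d s : aeq (AScale c (AScale d s)) (AScale (c * d) s)
| aeq_scale1 s : aeq (AScale 1 s) s
| aeq_scaleDr c s t : aeq (AScale c (AAdd s t)) (AAdd (AScale c s) (AScale c t))
| aeq_scaleDl c d s : aeq (AScale (c + d) s) (AAdd (AScale c s) (AScale d s))
| aeq_mulA s t u : aeq (AMul s (AMul t u)) (AMul (AMul s t) u)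
| aeq_mul1 s : aeq (AMul AOne s) s
| aeq_1mul s : aeq (AMul s AOne) s
| aeq_mulDl s t u : aeq (AMul (AAdd s t) u) (AAdd (AMul s u) (AMul t u))
| aeq_mulDr s t u : aeq (AMul s (AAdd t u)) (AAdd (AMul s t) (AMul s u))
| aeq_scaleAl c s t : aeq (AScale c (AMul s t)) (AMul (AScale c s) t)
| aeq_scaleAr c s t : aeq (AScale c (AMul s t)) (AMul s (AScale c t)).

Definition aeqb (s t : {classic aexpr k G}) : bool := `[< aeq s t >].

Lemma aeqb_refl : reflexive aeqb.
Proof. by move=> s; apply/asboolP; exact: aeq_refl. Qed.
Lemma aeqb_sym : symmetric aeqb.
Proof. by move=> s t; apply/asboolP/asboolP; exact: aeq_sym. Qed.
Lemma aeqb_trans : transitive aeqb.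
Proof.
by move=> t s u /asboolP st /asboolP tu; apply/asboolP; exact: aeq_trans tu.
Qed.
Canonical aeqb_equiv := EquivRel aeqb aeqb_refl aeqb_sym aeqb_trans.

Definition pres : Type := {eq_quot aeqb_equiv}.
HB.instance Definition _ := Choice.on pres.
HB.instance Definition _ := EqQuotient.on pres.

Definition aclass (s : aexpr k G) : pres := \pi_pres (s : {classic aexpr k G}).

Lemma aclassP s t : aclass s = aclass t <-> aeq s t.
Proof.
split; first by move/eqmodP/asboolP.
by move=> st; apply/eqmodP/asboolP.
Qed.

Lemma aclass_repr x : aclass (repr x) = x.
Proof. exact: reprK. Qed.

Lemma pres_quotP (P : pres -> Prop) : (forall s, P (aclass s)) -> forall x, P x.
Proof. by move=> H x; rewrite -(aclass_repr x); exact: H. Qed.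

Lemma aeq_repr s : aeq (repr (aclass s)) s.
Proof. by apply/aclassP; rewrite aclass_repr. Qed.

Definition pzero : pres := aclass AZero.
Definition pone : pres := aclass AOne.
Definition padd (x y : pres) : pres := aclass (AAdd (repr x) (repr y)).
Definition popp (x : pres) : pres := aclass (AOpp (repr x)).
Definition pscale (c : k) (x : pres) : pres := aclass (AScale c (repr x)).
Definition pmul (x y : pres) : pres := aclass (AMul (repr x) (repr y)).

Lemma paddE s t : padd (aclass s) (aclass t) = aclass (AAdd s t).
Proof. by apply/aclassP; apply: aeq_Add; exact: aeq_repr. Qed.
Lemma poppE s : popp (aclass s) = aclass (AOpp s).
Proof. by apply/aclassP; apply: aeq_Opp; exact: aeq_repr. Qed.
Lemma pscaleE c s : pscale c (aclass s) = aclass (AScale c s).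
Proof. by apply/aclassP; apply: aeq_Scale; exact: aeq_repr. Qed.
Lemma pmulE s t : pmul (aclass s) (aclass t) = aclass (AMul s t).
Proof. by apply/aclassP; apply: aeq_Mul; exact: aeq_repr. Qed.

Lemma paddA : associative padd.
Proof.
elim/pres_quotP=> s; elim/pres_quotP=> t; elim/pres_quotP=> u.
by rewrite !paddE; apply/aclassP; exact: aeq_addA.
Qed.
Lemma paddC : commutative padd.
Proof.
elim/pres_quotP=> s; elim/pres_quotP=> t.
by rewrite !paddE; apply/aclassP; exact: aeq_addC.
Qed.
Lemma padd0 : left_id pzero padd.
Proof. by elim/pres_quotP=> s; rewrite paddE; apply/aclassP; exact: aeq_add0. Qed.
Lemma paddN : left_inverse pzero popp padd.
Proof.
by elim/pres_quotP=> s; rewrite poppE paddE; apply/aclassP; exact: aeq_addN.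
Qed.
HB.instance Definition _ := GRing.isZmodule.Build pres paddA paddC padd0 paddN.

Lemma aclassD s t : aclass (AAdd s t) = aclass s + aclass t.
Proof. by rewrite [RHS]/GRing.add /= paddE. Qed.
Lemma aclassN s : aclass (AOpp s) = - aclass s.
Proof. by rewrite [RHS]/GRing.opp /= poppE. Qed.

Lemma pscaleA c d x : pscale c (pscale d x) = pscale (c * d) x.
Proof.
by elim/pres_quotP: x => s; rewrite !pscaleE; apply/aclassP; exact: aeq_scaleA.
Qed.
Lemma pscale1 : left_id 1 pscale.
Proof. by elim/pres_quotP=> s; rewrite pscaleE; apply/aclassP; exact: aeq_scale1. Qed.
Lemma pscaleDr : right_distributive pscale +%R.
Proof.
move=> c; elim/pres_quotP=> s; elim/pres_quotP=> t.
rewrite -aclassD !pscaleE -aclassD.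
by apply/aclassP; exact: aeq_scaleDr.
Qed.
Lemma pscaleDl x : {morph pscale^~ x : c d / c + d}.
Proof.
move=> c d; elim/pres_quotP: x => s; rewrite !pscaleE -aclassD.
by apply/aclassP; exact: aeq_scaleDl.
Qed.
HB.instance Definition _ :=
  GRing.Zmodule_isLmodule.Build k pres pscaleA pscale1 pscaleDr pscaleDl.

Lemma aclassZ c s : aclass (AScale c s) = c *: aclass s.
Proof. by rewrite [RHS]/GRing.scale /= pscaleE. Qed.

Lemma pmulA : associative pmul.
Proof.
elim/pres_quotP=> s; elim/pres_quotP=> t; elim/pres_quotP=> u.
by rewrite !pmulE; apply/aclassP; exact: aeq_mulA.
Qed.
Lemma pmul1 : left_id pone pmul.
Proof. by elim/pres_quotP=> s; rewrite pmulE; apply/aclassP; exact: aeq_mul1. Qed.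
Lemma p1mul : right_id pone pmul.
Proof. by elim/pres_quotP=> s; rewrite pmulE; apply/aclassP; exact: aeq_1mul. Qed.
Lemma pmulDl : left_distributive pmul +%R.
Proof.
elim/pres_quotP=> s; elim/pres_quotP=> t; elim/pres_quotP=> u.
rewrite -aclassD !pmulE -aclassD; apply/aclassP; exact: aeq_mulDl.
Qed.
Lemma pmulDr : right_distributive pmul +%R.
Proof.
elim/pres_quotP=> s; elim/pres_quotP=> t; elim/pres_quotP=> u.
rewrite -aclassD !pmulE -aclassD; apply/aclassP; exact: aeq_mulDr.
Qed.
Lemma pscaleAl c x y : c *: pmul x y = pmul (c *: x) y.
Proof.
elim/pres_quotP: x => s; elim/pres_quotP: y => t.
by rewrite pmulE -!aclassZ pmulE; apply/aclassP; exact: aeq_scaleAl.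
Qed.
Lemma pscaleAr c x y : c *: pmul x y = pmul x (c *: y).
Proof.
elim/pres_quotP: x => s; elim/pres_quotP: y => t.
by rewrite pmulE -!aclassZ pmulE; apply/aclassP; exact: aeq_scaleAr.
Qed.

Definition presAlg : pzAlg k :=
  @PzAlg k pres pone pmul pmulA pmul1 p1mul pmulDl pmulDr pscaleAl pscaleAr.

Definition gen (g : G) : presAlg := aclass (AGen g).
End Presentation.

Section PresentationLift.
Variables (k : comPzRingType) (G : Type) (B : pzAlg k) (f : G -> B).

Fixpoint aeval (s : aexpr k G) : B :=
  match s with
  | AZero => 0
  | AOne => 1
  | AGen g => f g
  | AAdd s t => aeval s + aeval t
  | AOpp s => - aeval s
  | AScale c s => c *: aeval s
  | AMul s t => aeval s * aeval t
  end.

Variable R : aexpr k G -> aexpr k G -> Prop.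

(* The universal property; only meaningful when f respects R. *)
Definition pres_lift (x : presAlg R) : B := aeval (repr (x : pres R)).

Hypothesis fR : forall s t, R s t -> aeval s = aeval t.

Lemma aeval_aeq s t : aeq R s t -> aeval s = aeval t.
Proof.
elim=> {s t} //=.
- by move=> s t u _ -> _ ->.
- by move=> s s' t t' _ -> _ ->.
- by move=> s s' _ ->.
- by move=> c s s' _ ->.
- by move=> s s' t t' _ -> _ ->.
- by move=> s t u; rewrite addrA.
- by move=> s t; rewrite addrC.
- by move=> s; rewrite add0r.
- by move=> s; rewrite addNr.
- by move=> c d s; rewrite scalerA.
- by move=> s; rewrite scale1r.
- by move=> c s t; rewrite scalerDr.
- by move=> c d s; rewrite scalerDl.
- by move=> s t u; rewrite mulrA.
- by move=> s; rewrite mul1r.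
- by move=> s; rewrite mulr1.
- by move=> s t u; rewrite mulrDl.
- by move=> s t u; rewrite mulrDr.
- by move=> c s t; rewrite pzscalerAl.
- by move=> c s t; rewrite pzscalerAr.
Qed.

Lemma pres_lift_class s : pres_lift (aclass R s) = aeval s.
Proof. by apply: aeval_aeq; exact: aeq_repr. Qed.

Lemma pres_liftE g : pres_lift (gen R g) = f g.
Proof. exact: pres_lift_class. Qed.

Lemma pres_lift_linear : linear pres_lift.
Proof.
move=> c; elim/pres_quotP=> s; elim/pres_quotP=> t.
rewrite (_ : c *: _ + _ = aclass R (AAdd (AScale c s) t)) ?pres_lift_class //.
by rewrite aclassD aclassZ.
Qed.

Lemma pres_liftM : {morph pres_lift : x y / x * y}.
Proof.
elim/pres_quotP=> s; elim/pres_quotP=> t.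
by rewrite [X in pres_lift X]/GRing.mul /= pmulE !pres_lift_class.
Qed.

Lemma pres_lift1 : pres_lift 1 = 1.
Proof. exact: (pres_lift_class AOne). Qed.
End PresentationLift.

Arguments pres_lift {k G B} f {R} x.

Lemma aeval_gen (k : comPzRingType) (G : Type) (R : aexpr k G -> aexpr k G -> Prop)
  (s : aexpr k G) : aeval (gen R) s = aclass R s.
Proof.
elim: s => //= [s -> t ->|s ->|c s ->|s -> t ->].
- by rewrite aclassD.
- by rewrite aclassN.
- exact: esym (aclassZ R c s).
- by rewrite [LHS]/GRing.mul /= pmulE.
Qed.

Lemma pres_rel (k : comPzRingType) (G : Type) (R : aexpr k G -> aexpr k G -> Prop)
  (s t : aexpr k G) : R s t -> aeval (gen R) s = aeval (gen R) t.
Proof. by move=> st; rewrite !aeval_gen; apply/aclassP; exact: aeq_rel. Qed.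

Section Frobenius.
Variables (k : comPzRingType) (A : superAlg k).

(* tr is a trace of parity eps making A a symmetric Frobenius superalgebra,    *)
(* with homogeneous basis b, b i of parity par i, and dual basis bv.  As k is  *)
(* even, tr having parity eps means that it kills the parity different from    *)
(* eps.                                                                        *)
Record symmetric_frobenius (eps : bool) (tr : {linear A -> k^o})
    (I : finType) (par : I -> bool) (b bv : I -> A) : Prop := {
  frob_parity : forall (p : bool) (a : A), homog p a -> p != eps -> tr a = 0;
  frob_sym : forall (p q : bool) (a a' : A), homog p a -> homog q a' ->
    tr (a * a') = psign (p && q) * tr (a' * a);
  frob_homog : forall i, homog (par i) (b i);
  frob_basis : forall a : A, exists! c : {ffun I -> k}, a = \sum_i c i *: b i;
  frob_dual : forall i j, tr (bv i * b j) = (i == j)%:R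
}.

(* 1 (x) ... (x) 1 (x) tau (x) 1 (x) ... (x) 1 with tau placed in the factors  *)
(* i+1 (for b) and i (for bv); it does not depend on the choice of basis.      *)
Definition tau (eps : bool) (I : finType) (par : I -> bool) (b bv : I -> A)
    (n i : nat) : tpow A n :=
  \sum_(l : I) psign (eps && par l) *:
    pure_tpow n (fun j => if j == i.+1 then b l else if j == i then bv l else 1).
End Frobenius.

Declare Scope aexpr_scope.
Delimit Scope aexpr_scope with aexpr.
Bind Scope aexpr_scope with aexpr.
Notation "s + t" := (AAdd s t) : aexpr_scope.
Notation "s * t" := (AMul s t) : aexpr_scope.
Notation "c *: s" := (AScale c%R s) : aexpr_scope.
Notation "0" := AZero : aexpr_scope.
Notation "1" := AOne : aexpr_scope.

Reserved Notation "s === t" (at level 70, no associativity).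

(* In the presentations below, indices start from 0: the generators indexed by *)
(* i : 'I_n stand for x_{i+1}, and those indexed by i : 'I_n.-1 for u_{i+1}.   *)

Section NilCoxeter.
Variables (k : comPzRingType) (n : nat).

Local Notation u := (@AGen k 'I_n.-1).

Inductive cox_rel : aexpr k 'I_n.-1 -> aexpr k 'I_n.-1 -> Prop :=
| cox_sq i : u i * u i === 0
| cox_comm (i j : 'I_n.-1) : (i.+1 < j)%N || (j.+1 < i)%N -> u i * u j === u j * u i
| cox_braid (i j : 'I_n.-1) : j = i.+1 :> nat -> u i * u j * u i === u j * u i * u j
where "s === t" := (cox_rel s%aexpr t%aexpr).

Definition nilCox : pzAlg k := presAlg cox_rel.
End NilCoxeter.

Section Pol.
Variables (k : comPzRingType) (A : superAlg k) (eps : bool) (n : nat).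

Inductive pol_gen := PolA of tpow A n | PolX of 'I_n.

Local Notation "''a_' a" := (@AGen k pol_gen (PolA a)) (at level 8, a at level 2).
Local Notation x i := (@AGen k pol_gen (PolX i)).

(* The relations pol_addA to pol_oneA say that A^{(x) n} maps to the presented *)
(* algebra by a homomorphism (free product of A^{(x) n} and a free algebra).   *)
Inductive pol_rel : aexpr k pol_gen -> aexpr k pol_gen -> Prop :=
| pol_addA a a' : 'a_(a + a')%R === 'a_a + 'a_a'
| pol_scaleA c a : 'a_(c *: a)%R === c *: 'a_a
| pol_mulA a a' : 'a_(a * a')%R === 'a_a * 'a_a'
| pol_oneA : 'a_(1%R) === 1
| pol_xx i j : i != j -> x i * x j === psign eps *: (x j * x i)
| pol_ax p a i : homog p a -> 'a_a * x i === psign (eps && p) *: (x i * 'a_a)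
where "s === t" := (pol_rel s%aexpr t%aexpr).

Definition Pol : pzAlg k := presAlg pol_rel.
End Pol.
Arguments PolX {k A n}.

Section NilHecke.
Variables (k : comPzRingType) (A : superAlg k) (eps : bool).
Variables (I : finType) (par : I -> bool) (b bv : I -> A) (n : nat).

Inductive nh_gen := NhA of tpow A n | NhX of 'I_n | NhU of 'I_n.-1.

Local Notation "''a_' a" := (@AGen k nh_gen (NhA a)) (at level 8, a at level 2).
Local Notation x i := (@AGen k nh_gen (NhX i)).
Local Notation u i := (@AGen k nh_gen (NhU i)).
Local Notation tau_ i := (tau eps par b bv n i).

(* All relations are homogeneous for the parities of the generators, so this   *)
(* is the algebra underlying the superalgebra with the same presentation.      *)
Inductive nh_rel : aexpr k nh_gen -> aexpr k nh_gen -> Prop :=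
| nh_addA a a' : 'a_(a + a')%R === 'a_a + 'a_a'
| nh_scaleA c a : 'a_(c *: a)%R === c *: 'a_a
| nh_mulA a a' : 'a_(a * a')%R === 'a_a * 'a_a'
| nh_oneA : 'a_(1%R) === 1
| nh_uu i : u i * u i === 0
| nh_comm (i j : 'I_n.-1) : (i.+1 < j)%N || (j.+1 < i)%N -> u i * u j === u j * u i
| nh_braid (i j : 'I_n.-1) : j = i.+1 :> nat -> u i * u j * u i === u j * u i * u j
| nh_ua i a : u i * 'a_a === 'a_(superperm i a) * u i
| nh_xx i j : i != j -> x i * x j === psign eps *: (x j * x i)
| nh_ax p a i : homog p a -> 'a_a * x i === psign (eps && p) *: (x i * 'a_a)
| nh_xu (i : 'I_n.-1) (j : 'I_n) :
    j != i :> nat -> j != i.+1 :> nat -> x j * u i === u i * x j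
| nh_ux (i : 'I_n.-1) (j j' : 'I_n) : j = i :> nat -> j' = i.+1 :> nat ->
    u i * x j' === x j * u i + 'a_(tau_ i)
| nh_xu_succ (i : 'I_n.-1) (j j' : 'I_n) : j = i :> nat -> j' = i.+1 :> nat ->
    x j' * u i === u i * x j + psign eps *: 'a_(tau_ i)
where "s === t" := (nh_rel s%aexpr t%aexpr).

Definition nilHecke : pzAlg k := presAlg nh_rel.

Definition pol_to_nilHecke : Pol A eps n -> nilHecke :=
  pres_lift (fun g => gen nh_rel match g with PolA a => NhA a | PolX i => NhX i end).

Definition nilCox_to_nilHecke : nilCox k n -> nilHecke :=
  pres_lift (fun i => gen nh_rel (NhU i)).

Lemma pol_rel_nilHecke s t : pol_rel eps s t ->
  aeval (fun g => gen nh_rel match g with PolA a => NhA a | PolX i => NhX i end) s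
  = aeval (fun g => gen nh_rel match g with PolA a => NhA a | PolX i => NhX i end) t.
Proof.
case=> {s t} [a a'|c a|a a'| |i j ij|p a i ha].
- exact: (pres_rel (nh_addA a a')).
- exact: (pres_rel (nh_scaleA c a)).
- exact: (pres_rel (nh_mulA a a')).
- exact: (pres_rel nh_oneA).
- exact: (pres_rel (nh_xx ij)).
- exact: (pres_rel (nh_ax i ha)).
Qed.

Lemma cox_rel_nilHecke s t : @cox_rel k n s t ->
  aeval (fun i => gen nh_rel (NhU i)) s = aeval (fun i => gen nh_rel (NhU i)) t.
Proof.
case=> {s t} [i|i j ij|i j ij].
- exact: (pres_rel (nh_uu i)).
- exact: (pres_rel (nh_comm ij)).
- exact: (pres_rel (nh_braid ij)).
Qed.

Lemma pol_to_nilHeckeA a :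
  pol_to_nilHecke (gen _ (PolA a)) = gen _ (NhA a).
Proof. exact: pres_liftE pol_rel_nilHecke _. Qed.
Lemma pol_to_nilHeckeX i :
  pol_to_nilHecke (gen _ (PolX i)) = gen _ (NhX i).
Proof. exact: pres_liftE pol_rel_nilHecke _. Qed.
Lemma pol_to_nilHecke_linear : linear pol_to_nilHecke.
Proof. exact: pres_lift_linear pol_rel_nilHecke. Qed.
Lemma pol_to_nilHeckeM : {morph pol_to_nilHecke : f g / f * g}.
Proof. exact: pres_liftM pol_rel_nilHecke. Qed.
Lemma pol_to_nilHecke1 : pol_to_nilHecke 1 = 1.
Proof. exact: pres_lift1 pol_rel_nilHecke. Qed.

Lemma nilCox_to_nilHeckeU i :
  nilCox_to_nilHecke (gen _ i) = gen _ (NhU i).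
Proof. exact: pres_liftE cox_rel_nilHecke _. Qed.
Lemma nilCox_to_nilHecke_linear : linear nilCox_to_nilHecke.
Proof. exact: pres_lift_linear cox_rel_nilHecke. Qed.
Lemma nilCox_to_nilHeckeM : {morph nilCox_to_nilHecke : y z / y * z}.
Proof. exact: pres_liftM cox_rel_nilHecke. Qed.
Lemma nilCox_to_nilHecke1 : nilCox_to_nilHecke 1 = 1.
Proof. exact: pres_lift1 cox_rel_nilHecke. Qed.

Definition mult_fun : tens (Pol A eps n) (nilCox k n) -> nilHecke :=
  tens_lift (fun f z => pol_to_nilHecke f * nilCox_to_nilHecke z).

Lemma mult_bilinear :
  bilinear_map (fun f z => pol_to_nilHecke f * nilCox_to_nilHecke z).
Proof.
split=> [z c f f'|f c z z'].
- by rewrite pol_to_nilHecke_linear mulrDl -pzscalerAl.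
- by rewrite nilCox_to_nilHecke_linear mulrDr -pzscalerAr.
Qed.

Lemma mult_fun_linear : linear mult_fun.
Proof. exact: tens_lift_linear mult_bilinear. Qed.

HB.instance Definition _ := GRing.isLinear.Build k
  (tens (Pol A eps n) (nilCox k n)) nilHecke *:%R mult_fun mult_fun_linear.

Definition mult_map : {linear tens (Pol A eps n) (nilCox k n) -> nilHecke} :=
  mult_fun.

Lemma mult_mapE f z :
  mult_map (pure f z) = pol_to_nilHecke f * nilCox_to_nilHecke z.
Proof. exact: tens_liftE mult_bilinear _ _. Qed.
End NilHecke.
Arguments NhX {k A n}.
Arguments NhU {k A n}.

(* Main.v *)
From HB Require Import structures.
Require Import Defs.
From mathcomp Require Import all_boot all_order all_algebra zify.
From mathcomp Require Import boolp functions.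

(* Pol_n(A) (x) nilCox_n carries an action of nilHecke_n(A): polynomials act by
   left multiplication on the first factor, and u_i acts by
     u_i (f (x) z) = s_i(f) (x) u_i z + d_i(f) (x) z,
   where s_i extends the superpermutation, s_i(x_i) = x_{i+1}, and d_i is the
   s_i-twisted derivation with d_i(a) = 0, d_i(x_{i+1}) = tau_i and
   d_i(x_i) = -(-1)^eps tau_i.  Evaluating this action at 1 (x) 1 is the inverse
   of the multiplication map, so no basis of either factor is needed.  That the
   operators satisfy a relation W = 0 among the u_i only has to be seen on the
   vectors 1 (x) z, provided W commutes with left multiplication by generators
   up to other operators on its left (endo_eq0).  The Frobenius structure enters
   through s_i(tau_i) = (-1)^eps tau_i and
   s_i(a) tau_i = (-1)^{eps |a|} tau_i a. *)

Set Implicit Arguments.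
Unset Strict Implicit.
Unset Printing Implicit Defensive.

Import GRing.Theory.
Local Open Scope ring_scope.

(** * Consequences of linearity for unbundled maps *)

Section LinearMaps.
Variables (k : comPzRingType) (M N : lmodType k) (f : M -> N).
Hypothesis fl : linear f.

Lemma linear_fun0 : f 0 = 0.
Proof. by have := fl (-1) 0 0; rewrite scaler0 addr0 scaleN1r addNr. Qed.
Lemma linear_funD x y : f (x + y) = f x + f y.
Proof. by have := fl 1 x y; rewrite !scale1r. Qed.
Lemma linear_funZ c x : f (c *: x) = c *: f x.
Proof. by have := fl c x 0; rewrite linear_fun0 !addr0. Qed.
Lemma linear_fun_sum (I : finType) (F : I -> M) : f (\sum_i F i) = \sum_i f (F i).
Proof. exact: (big_morph f linear_funD linear_fun0). Qed.
End LinearMaps.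

(** * Superalgebra morphisms and superpermutations *)

Section SuperMorphism.
Variables (k : comPzRingType).

Record super_hom (A B : superAlg k) (f : A -> B) : Prop := {
  super_hom_linear : linear f;
  super_homM : {morph f : x y / x * y};
  super_hom1 : f 1 = 1;
  super_hom_homog : forall p a, homog p a -> homog p (f a)
}.

Lemma super_hom_id (A : superAlg k) : super_hom (@id A).
Proof. by split. Qed.

Variables (A : superAlg k).

Lemma tensM (B C : superAlg k) p q (a' : B) (b : C) (a : B) (b' : C) :
  homog p b -> homog q a ->
  (pure a' b : tens_super B C) * pure a b'
  = psign (p && q) *: pure (a' * a) (b * b').
Proof. exact: tmulE. Qed.

Lemma homog_pure (B C : superAlg k) p q (b : B) (c : C) :
  homog p b -> homog q c -> homog (p (+) q) (pure b c : tens_super B C).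
Proof. by move=> hb hc; rewrite /homog /= (thpartE _ hb hc) eqxx. Qed.

(** The sign in a product of pure tensors depends only on parities, which [f] preserves, so on
    homogeneous pure tensors both sides carry the same sign. *)
Lemma tens_map_super_hom (B C : superAlg k) (f : B -> C) : super_hom f ->
  super_hom (tens_map id f : tens_super A B -> tens_super A C).
Proof.
move=> [fl fM f1 fh].
have idl : linear (@id A) by [].
have tl := tens_map_linear idl fl.
split=> //.
- move=> x y.
  elim/tens_homog_ind: x => [|x y' IH1 IH2|p1 q1 a1 b1 ha1 hb1].
  + by rewrite (linear_fun0 tl) !mul0r (linear_fun0 tl).
  + by rewrite mulrDl !(linear_funD tl) IH1 IH2 mulrDl.
  elim/tens_homog_ind: y => [|x y IH1 IH2|p2 q2 a2 b2 ha2 hb2].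
  + by rewrite (linear_fun0 tl) !mulr0 (linear_fun0 tl).
  + by rewrite mulrDr !(linear_funD tl) IH1 IH2 mulrDr.
  rewrite (tensM _ _ hb1 ha2) (linear_funZ tl) !tens_mapE //.
  by rewrite (tensM _ _ (fh _ _ hb1) ha2) fM.
- by rewrite [LHS]tens_mapE // f1.
- move=> p x; rewrite /homog /= => <-.
  elim/tens_homog_ind: x => [|x y IH1 IH2|p1 q1 a1 b1 ha1 hb1].
  + by rewrite !(thpart0, linear_fun0 tl).
  + by rewrite thpartD (linear_funD tl) thpartD IH1 IH2.
  rewrite (thpartE _ ha1 hb1); case: eqP => [->|_].
    by rewrite tens_mapE // (thpartE _ ha1 (fh _ _ hb1)) eqxx.
  by rewrite (linear_fun0 tl) thpart0.
Qed.

Variable T : superAlg k.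
Local Notation AAT := (tens_super A (tens_super A T)).

Lemma tens3_homog_ind (P : AAT -> Prop) :
  P 0 -> (forall x y, P x -> P y -> P (x + y)) ->
  (forall p q r (a b : A) (t : T), homog p a -> homog q b -> homog r t ->
     P (pure a (pure b t : tens_super A T))) ->
  forall x, P x.
Proof.
move=> P0 PD Pp; apply: tens_ind => // a x.
elim/tens_homog_ind: x => [|x y IH1 IH2|p q b t hb ht].
- by rewrite pure0r.
- by rewrite pureDr; apply: PD.
- rewrite -(hpart_sum a) pureDl; apply: PD; apply: Pp hb ht; exact: homog_hpart.
Qed.

(** On homogeneous pure tensors both sides are the same tensor up to sign, and the signs are
    compared over all parities. *)
Lemma tswap_super_hom : super_hom (@tswap k A T : AAT -> AAT).
Proof.
have tl : linear (@tswap k A T : AAT -> AAT) := @tswap_linear k A T.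
split=> //.
- move=> x y.
  elim/tens3_homog_ind: x => [|x y' IH1 IH2|p1 q1 r1 a1 b1 t1 ha1 hb1 ht1].
  + by rewrite (linear_fun0 tl) !mul0r (linear_fun0 tl).
  + by rewrite mulrDl !(linear_funD tl) IH1 IH2 mulrDl.
  elim/tens3_homog_ind: y => [|x y IH1 IH2|p2 q2 r2 a2 b2 t2 ha2 hb2 ht2].
  + by rewrite (linear_fun0 tl) !mulr0 (linear_fun0 tl).
  + by rewrite mulrDr !(linear_funD tl) IH1 IH2 mulrDr.
  rewrite (tensM _ _ (homog_pure hb1 ht1) ha2) (linear_funZ tl).
  rewrite (tensM _ _ ht1 hb2) pureZr (linear_funZ tl).
  rewrite !(tswapE _ (homogM ha1 ha2) (homogM hb1 hb2)).
  rewrite (tswapE _ ha1 hb1) (tswapE _ ha2 hb2) -pzscalerAl -pzscalerAr.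
  rewrite (tensM _ _ (homog_pure ha1 ht1) hb2) (tensM _ _ ht1 ha2) pureZr.
  rewrite !scalerA -!psignD; congr (psign _ *: _).
  by case: p1 q1 r1 p2 q2 {ha1 hb1 ht1 ha2 hb2} => [] [] [] [] [].
- by rewrite [LHS](tswapE _ (homog1 A) (homog1 A)) scale1r.
- move=> p x; rewrite /homog /= => <-.
  elim/tens3_homog_ind: x => [|x y IH1 IH2|p1 q1 r1 a1 b1 t1 ha1 hb1 ht1].
  + by rewrite !(thpart0, linear_fun0 tl).
  + by rewrite thpartD (linear_funD tl) thpartD IH1 IH2.
  rewrite (thpartE _ ha1 (homog_pure hb1 ht1)); case: eqP => [->|_].
    rewrite (tswapE _ ha1 hb1) thpartZ (thpartE _ hb1 (homog_pure ha1 ht1)).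
    by rewrite addbCA eqxx.
  by rewrite (linear_fun0 tl) thpart0.
Qed.
End SuperMorphism.

Section Superperm.
Variables (k : comPzRingType) (A : superAlg k).

Lemma superperm_super_hom i n : super_hom (@superperm k A i n).
Proof.
elim: n => [|n IHn] /=; first exact: super_hom_id.
case: eqP => _; last exact: tens_map_super_hom.
by case: n {IHn} => [|n]; [exact: super_hom_id | exact: tswap_super_hom].
Qed.

(** This is the commutation of the top superpermutation with those acting on the factors further
    right. *)
Lemma tswap_natural (T T' : superAlg k) (f : T -> T') : linear f ->
  forall x, tswap (tens_map id (tens_map id f) x)
  = tens_map id (tens_map id f) (@tswap k A T x).
Proof.
move=> fl.
have idl : linear (@id A) by [].
have tl := tens_map_linear idl fl.
have ttl := tens_map_linear idl tl.
elim/tens3_homog_ind => [|x y IH1 IH2|p q r a b t ha hb ht].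
- by rewrite !(linear_fun0 ttl, linear_fun0 (@tswap_linear _ _ _)).
- by rewrite !(linear_funD ttl, linear_funD (@tswap_linear _ _ _)) IH1 IH2.
- rewrite tens_mapE // tens_mapE // !(tswapE _ ha hb) (linear_funZ ttl).
  by rewrite tens_mapE // tens_mapE.
Qed.

Lemma tens_map_comp (M B C D : superAlg k) (f : B -> C) (g : C -> D) :
  linear f -> linear g -> forall x : tens M B,
  tens_map id g (tens_map id f x) = tens_map id (g \o f) x.
Proof.
move=> fl gl; have idl : linear (@id M) by [].
have gfl : linear (g \o f) by move=> c x y; rewrite /= fl gl.
apply: tens_ext => [c x y||m n].
- by rewrite !tens_map_linear.
- exact: tens_map_linear.
- by rewrite !tens_mapE.
Qed.

Lemma eq_tens_map (M B C : superAlg k) (f g : B -> C) :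
  linear f -> linear g -> f =1 g -> forall x : tens M B,
  tens_map id f x = tens_map id g x.
Proof.
move=> fl gl fg; have idl : linear (@id M) by [].
apply: tens_ext => [||m n]; try exact: tens_map_linear.
by rewrite !tens_mapE // fg.
Qed.

Lemma superperm_top i : @superperm k A i i.+2 = @tswap k A (tpow A i).
Proof. by rewrite /= eqxx. Qed.

Lemma superperm_low i n : i.+1 != n ->
  @superperm k A i n.+1 = tens_map id (@superperm k A i n).
Proof. by move=> /= /negbTE->. Qed.

Lemma superperm_comm i j n (a : tpow A n) : (i.+1 < j)%N ->
  superperm i (superperm j a) = superperm j (superperm i a).
Proof.
move=> ij; elim: n a => // n IHn a.
have lin l m : linear (@superperm k A l m) by exact: superperm_linear.
have idl : linear (@id A) by [].
(* If [i] swaps the two leftmost factors, then [j] exceeds the range and [superperm j] passes down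
   to the remaining factors, so naturality applies here too. *)
have [En|ni] := eqVneq i.+1 n.
  case: n / En IHn a => _ a.
  have ji : j != i by rewrite gtn_eqF // ltnW.
  have jSi : j.+1 != i by rewrite gtn_eqF // ltnS ltnW // ltnW.
  rewrite superperm_top !(superperm_low (i := j)) ?eqSS //.
  exact: tswap_natural.
have [En|nj] := eqVneq j.+1 n.
  case: n / En ni IHn a => _ _ a; case: j ij a => // j ij a.
  have ni : i != j.+1 by rewrite ltn_eqF // ltnW.
  have nj : i != j by rewrite ltn_eqF.
  rewrite superperm_top (superperm_low (n := j.+2)) // (superperm_low (n := j.+1)) //.
  symmetry; apply: tswap_natural; exact: (lin i j.+1).
rewrite !superperm_low // !tens_map_comp //; apply: eq_tens_map => // c x y.
- by rewrite /= !lin.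
- by rewrite /= !lin.
Qed.

(** Both sides reverse the first three factors, and each pair of them crosses exactly once, so the
    signs are the same product of three. *)
Lemma tswap_braid (T : superAlg k) :
  let s1 : tens_super A (tens_super A T) -> tens_super A (tens_super A T) :=
    @tswap k A T in
  forall x : tens_super A (tens_super A (tens_super A T)),
  @tswap k A (tens_super A T) (tens_map id s1 (@tswap k A (tens_super A T) x))
  = tens_map id s1 (@tswap k A (tens_super A T) (tens_map id s1 x)).
Proof.
move=> s1 x.
have idl : linear (@id A) by [].
have sl := @tswap_linear k A (tens_super A T).
have s1l : linear s1 := @tswap_linear k A T.
have rl := tens_map_linear idl s1l.
elim/tens3_homog_ind: x => [|x y IH1 IH2|p q r a b t ha hb ht].
- by rewrite !(linear_fun0 sl, linear_fun0 rl).
- by rewrite !(linear_funD sl, linear_funD rl) IH1 IH2.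
elim/tens_homog_ind: t {r ht} => [|x y IH1 IH2|r s c t hc ht].
- by rewrite !(pure0r, linear_fun0 sl, linear_fun0 rl).
- by rewrite !(pureDr, linear_funD sl, linear_funD rl) IH1 IH2.
have mE y z : tens_map id s1 (pure y z) = pure y (s1 z) by rewrite tens_mapE.
rewrite !(mE, tswapE _ ha hb, tswapE _ ha hc, tswapE _ hb hc,
  tswapE _ ha hb : s1 _ = _, tswapE _ ha hc : s1 _ = _, tswapE _ hb hc : s1 _ = _,
  pureZr, linear_funZ sl, linear_funZ rl, scalerA).
congr (_ *: _).
by rewrite -!psignD; case: p q r {ha hb hc} => [] [] [].
Qed.

Lemma superperm_braid i n (a : tpow A n) : (i.+2 < n)%N ->
  superperm i (superperm i.+1 (superperm i a))
  = superperm i.+1 (superperm i (superperm i.+1 a)).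
Proof.
elim: n a => // n IHn a.
have lin l m : linear (@superperm k A l m) by exact: superperm_linear.
have idl : linear (@id A) by [].
rewrite ltnS leq_eqVlt => /orP[/eqP En|lt_in].
  case: n / En IHn a => _ a.
  rewrite superperm_top superperm_low ?eqSS ?ltn_eqF // superperm_top.
  exact/esym/tswap_braid.
have ni : i.+1 != n by rewrite ltn_eqF // ltnW.
have nj : i.+2 != n by rewrite ltn_eqF.
rewrite !superperm_low // !tens_map_comp //; try by move=> c x y; rewrite /= !lin.
apply: eq_tens_map => [c x y|c x y|x] /=.
- by rewrite !lin.
- by rewrite !lin.
- exact: IHn.
Qed.

Lemma superpermK i n : involutive (@superperm k A i n).
Proof.
elim: n => // n IHn a.
have idl : linear (@id A) by [].
have lin l m : linear (@superperm k A l m) by exact: superperm_linear.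
have [En|ni] := eqVneq i.+1 n; last first.
  (* Below the top, and for [i] out of range, the claim reduces by induction to [tens_map id id]
     being the identity. *)
  rewrite superperm_low // tens_map_comp //.
  rewrite (eq_tens_map (g := id)) //; last by move=> c x y; rewrite /= !lin.
  by elim/tens_ind: a => [|x y IH1 IH2|x y]; rewrite ?tens_mapE //
    ?(linear_fun0 (tens_map_linear idl _)) ?(linear_funD (tens_map_linear idl _)) // IH1 IH2.
case: n / En IHn a => _ a.
have sl := @tswap_linear k A (tpow A i).
rewrite superperm_top; elim/tens3_homog_ind: a => [|x y IH1 IH2|p q r x y t hx hy ht].
- by rewrite !(linear_fun0 sl).
- by rewrite !(linear_funD sl) IH1 IH2.
rewrite (tswapE _ hx hy) (linear_funZ sl) (tswapE _ hy hx) scalerA andbC psignK.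
exact: scale1r.
Qed.

End Superperm.

(** * The Casimir element of a symmetric Frobenius superalgebra *)

Section Frobenius.
Variables (k : comPzRingType) (A : superAlg k) (eps : bool).
Variables (tr : {linear A -> k^o}) (I : finType) (par : I -> bool) (b bv : I -> A).
Hypothesis hA : symmetric_frobenius eps tr par b bv.

Lemma frob_coord a : a = \sum_l tr (bv l * a) *: b l.
Proof.
have [c [Ea _]] := frob_basis hA a.
rewrite [LHS]Ea; apply: eq_bigr => l _; congr (_ *: _).
rewrite Ea mulr_sumr linear_sum (bigD1 l) //= big1 => [|m ml].
  by rewrite -pzscalerAr linearZ /= (frob_dual hA) eqxx addr0 /GRing.scale /= mulr1.
by rewrite -pzscalerAr linearZ /= (frob_dual hA) eq_sym (negbTE ml) scaler0.
Qed.

(** By [frob_coord] it is enough that [tr (bv l * a) = 0]. Supersymmetry of [tr] turns this into a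
    statement about [a] on the left, but only for homogeneous elements, whence the splitting into
    parts. *)
Lemma frob_left_nondegenerate a : (forall j, tr (a * b j) = 0) -> a = 0.
Proof.
move=> ab0.
have ax0 x : tr (a * x) = 0.
  rewrite (frob_coord x) mulr_sumr linear_sum big1 // => l _.
  by rewrite -pzscalerAr linearZ /= ab0 scaler0.
(* For fixed [q] only one part of [a] can give a product of parity [eps], so its trace is the whole
   of [tr (a * hpart q x)], which vanishes. *)
have parts p q x : tr (hpart p a * hpart q x) = 0.
  have tr0 p' : p' (+) q != eps -> tr (hpart p' a * hpart q x) = 0.
    by apply: (frob_parity hA); apply: homogM; exact: homog_hpart.
  have [pq|/tr0//] := eqVneq (p (+) q) eps.
  have := ax0 (hpart q x); rewrite -{1}(hpart_sum a) mulrDl linearD /=.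
  case: p pq => pq.
    by rewrite tr0 ?add0r //; case: q eps pq {tr0} => [] [].
  by rewrite (tr0 true) ?addr0 //; case: q eps pq {tr0} => [] [].
rewrite (frob_coord a) big1 // => l _.
have swap p q : tr (hpart p (bv l) * hpart q a) = 0.
  by rewrite (frob_sym hA (homog_hpart _ _) (homog_hpart _ _)) parts mulr0.
by rewrite -(hpart_sum (bv l)) -(hpart_sum a) mulrDl !mulrDr !linearD /= !swap !addr0 scale0r.
Qed.

(** The difference of the two sides pairs to zero with every [b j] from the right, so nondegeneracy
    applies. *)
Lemma frob_coord_dual a : a = \sum_l tr (a * b l) *: bv l.
Proof.
apply/eqP; rewrite -subr_eq0; apply/eqP.
apply: frob_left_nondegenerate => j.
rewrite mulrBl linearB /= mulr_suml linear_sum (bigD1 j) //= big1 => [|l lj].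
  by rewrite -pzscalerAl linearZ /= (frob_dual hA) eqxx addr0 /GRing.scale /= mulr1 subrr.
by rewrite -pzscalerAl linearZ /= (frob_dual hA) (negbTE lj) scaler0.
Qed.

(** The part of [bv l] of the wrong parity is orthogonal to every [b j]. Either the product has
    parity other than [eps], or [j] differs from [l] and the right part contributes nothing, so that
    duality gives 0. *)
Lemma homog_dual_basis l : homog (par l (+) eps) (bv l).
Proof.
suff: hpart (~~ (par l (+) eps)) (bv l) = 0.
  rewrite /homog => h0; rewrite -[in RHS](hpart_sum (bv l)); move: h0.
  by case: (par l (+) eps) => /= ->; rewrite ?addr0 ?add0r.
apply: frob_left_nondegenerate => j.
have tr0 p : p (+) par j != eps -> tr (hpart p (bv l) * b j) = 0.
  by apply: (frob_parity hA); apply: homogM; [exact: homog_hpart | exact: frob_homog hA j].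
have [Ej|/tr0//] := eqVneq (~~ (par l (+) eps) (+) par j) eps.
have lj : l != j by apply/eqP => Elj; move: Ej; rewrite Elj; case: (par j) (eps) => [] [].
have other : tr (hpart (par l (+) eps) (bv l) * b j) = 0.
  by apply: tr0; case: (par l) (par j) (eps) Ej => [] [] [].
have := frob_dual hA l j; rewrite (negbTE lj) -{1}(hpart_sum (bv l)) mulrDl linearD /=.
by case: (par l (+) eps) other => /= ->; rewrite ?addr0 ?add0r.
Qed.

(** Signs in front of a trace need to agree only under the parity constraint that lets the trace be
    nonzero. *)
Lemma frob_sign p (s s' : bool) x : homog p x -> (p = eps -> s = s') ->
  psign s * tr x = psign s' * tr x.
Proof.
move=> hx ss'; have [/ss'->//|pe] := eqVneq p eps.
by rewrite (frob_parity hA hx pe) !mulr0.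
Qed.

Section Casimir.
Variables (V : lmodType k) (F : A -> A -> V).
Hypothesis FB : bilinear_map F.

Lemma bilin_suml (c : I -> k) (x : I -> A) y :
  F (\sum_i c i *: x i) y = \sum_i c i *: F (x i) y.
Proof.
rewrite (linear_fun_sum (proj1 FB y)); apply: eq_bigr => i _.
exact: (linear_funZ (proj1 FB y)).
Qed.
Lemma bilin_sumr (c : I -> k) x (y : I -> A) :
  F x (\sum_i c i *: y i) = \sum_i c i *: F x (y i).
Proof.
rewrite (linear_fun_sum (proj2 FB x)); apply: eq_bigr => i _.
exact: (linear_funZ (proj2 FB x)).
Qed.

(** Expanding [a * b l] in the basis and [bv m * a] in the dual basis gives the same coefficients
    [tr (bv m * a * b l)]. The bilinear [F] stands for whatever surrounds the two factors, and [s]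
    absorbs the sign twist this causes. *)
Lemma casimir_mull (s q : bool) a : homog q a ->
  \sum_l psign (s && par l) *: F (a * b l) (bv l)
  = psign (s && q) *: \sum_l psign (s && par l) *: F (b l) (bv l * a).
Proof.
move=> ha.
under eq_bigr => l _ do rewrite (frob_coord (a * b l)) bilin_suml scaler_sumr.
rewrite exchange_big scaler_sumr; apply: eq_bigr => m _ /=.
rewrite [in RHS](frob_coord_dual (bv m * a)) bilin_sumr !scaler_sumr.
apply: eq_bigr => l _; rewrite !scalerA mulrA -psignD; congr (_ *: _).
have h := homogM (homogM (homog_dual_basis m) ha) (frob_homog hA l).
apply: (frob_sign h) => E; case: s; case: q E {ha h};
  by case: (par l); case: (par m); case: eps.
Qed.

(** The coefficients are now [tr (a * bv l * b m)] and [tr (bv l * b m * a)], equal up to sign by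
    supersymmetry. The twist [eps (+) p] is the one for which that sign turns [par l] into
    [par m]. *)
Lemma casimir_mulr (p : bool) a : homog p a ->
  \sum_l psign ((eps (+) p) && par l) *: F (b l) (a * bv l)
  = \sum_l psign ((eps (+) p) && par l) *: F (b l * a) (bv l).
Proof.
move=> ha.
under eq_bigr => l _ do rewrite (frob_coord_dual (a * bv l)) bilin_sumr scaler_sumr.
rewrite exchange_big; apply: eq_bigr => m _ /=.
rewrite [in RHS](frob_coord (b m * a)) bilin_suml !scaler_sumr.
apply: eq_bigr => l _; rewrite !scalerA; congr (_ *: _).
have h := homogM (homog_dual_basis l) (frob_homog hA m).
rewrite -mulrA (frob_sym hA ha h) [in RHS]mulrA [LHS]mulrA -psignD.
apply: (frob_sign (homogM h ha)) => E; case: p E {ha h};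
  by case: (par l); case: (par m); case: eps.
Qed.

(** Both sides expand to sums over pairs [b m], [b l] with coefficients [tr (bv m * bv l)] and
    [tr (bv l * bv m)], related by supersymmetry. *)
Lemma casimir_swap :
  \sum_l psign (par l) *: F (bv l) (b l)
  = psign eps *: \sum_l psign (eps && par l) *: F (b l) (bv l).
Proof.
under eq_bigr => l _ do rewrite (frob_coord (bv l)) bilin_suml scaler_sumr.
rewrite exchange_big scaler_sumr; apply: eq_bigr => m _ /=.
rewrite [in RHS](frob_coord (bv m)) bilin_sumr !scaler_sumr.
apply: eq_bigr => l _; rewrite !scalerA; congr (_ *: _).
have h := homogM (homog_dual_basis l) (homog_dual_basis m).
rewrite (frob_sym hA (homog_dual_basis m) (homog_dual_basis l)) mulrA -!psignD.
apply: (frob_sign h) => E; move: E {h};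
  by case: (par l); case: (par m); case: eps.
Qed.
End Casimir.
End Frobenius.

(** * The elements tau_i: teleportation and superpermutations *)

Section Tau.
Variables (k : comPzRingType) (A : superAlg k) (eps : bool).
Variables (tr : {linear A -> k^o}) (I : finType) (par : I -> bool) (b bv : I -> A).
Hypothesis hA : symmetric_frobenius eps tr par b bv.

Local Notation AAT T := (tens_super A (tens_super A T)).
Local Notation tau := (tau eps par b bv).

(** This is [tau] in the two leftmost factors, the others being collected in an arbitrary [T]; it is
    the base case of the inductions on [n]. *)
Definition casimir (T : superAlg k) : AAT T :=
  \sum_l psign (eps && par l) *: (pure (b l) (pure (bv l) (1 : T)) : AAT T).

Lemma pure_tpow1 n (a : nat -> A) : (forall j, (j < n)%N -> a j = 1) ->
  pure_tpow n a = 1.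
Proof.
elim: n => //= n IHn a1; rewrite a1 // IHn // => j jn.
by apply: a1; exact: ltnW.
Qed.

Lemma tau_top i : tau i.+2 i = casimir (tpow A i).
Proof.
apply: eq_bigr => l _ /=; rewrite !eqxx (ltn_eqF (ltnSn i)).
congr (_ *: pure _ (pure _ _)); apply: pure_tpow1 => j ji.
by rewrite !ltn_eqF // ltnW.
Qed.

Lemma tau_low i n : (i.+1 < n)%N -> tau n.+1 i = pure (1 : A) (tau n i).
Proof.
move=> lt_in; rewrite [RHS](linear_fun_sum (proj2 (pure_bilinear A (tpow A n)) 1)).
apply: eq_bigr => l _; rewrite pureZr /= !gtn_eqF //; exact: ltnW.
Qed.

Lemma casimir_homog T : homog eps (casimir T).
Proof.
rewrite /homog (linear_sum (hpart eps)); apply: eq_bigr => l _; rewrite linearZ /=.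
congr (_ *: _).
have := homog_pure (frob_homog hA l) (homog_pure (homog_dual_basis hA l) (homog1 T)).
by rewrite addbF addKb.
Qed.

Lemma tau_homog i n : (i.+1 < n)%N -> homog eps (tau n i).
Proof.
elim: n => // n IHn; rewrite ltnS leq_eqVlt => /orP[/eqP En|lt_in].
  case: n / En {IHn}; rewrite tau_top; exact: casimir_homog.
rewrite tau_low //; exact: homog_pure (homog1 A) (IHn lt_in).
Qed.

(** This is the condition under which an [s]-twisted derivation killing [x] and sending a polynomial
    generator to [t] respects the supercommutation of the two. *)
Definition teleports (B : superAlg k) (s : B -> B) (t : B) : Prop :=
  forall p x, homog p x -> s x * t = psign (eps && p) *: (t * x).

Lemma teleports_pure (B : superAlg k) (s : tens_super A B -> tens_super A B) t :
  linear s ->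
  (forall p q (a : A) (x : B), homog p a -> homog q x ->
    s (pure a x) * t = psign (eps && (p (+) q)) *: (t * pure a x)) ->
  teleports s t.
Proof.
move=> sl sp p x; rewrite /homog /= => <-.
elim/tens_homog_ind: x => [|x y IH1 IH2|p1 q1 a1 x1 ha1 hx1].
- by rewrite thpart0 (linear_fun0 sl) mul0r mulr0 scaler0.
- by rewrite thpartD (linear_funD sl) mulrDl mulrDr IH1 IH2 scalerDr.
rewrite (thpartE _ ha1 hx1); case: eqP => [->|_]; first exact: sp.
by rewrite (linear_fun0 sl) mul0r mulr0 scaler0.
Qed.

Lemma tens1M (B : superAlg k) q (t : B) (a : A) x : homog q a ->
  forall p, homog p t ->
  (pure (1 : A) t : tens_super A B) * pure a x = psign (p && q) *: pure a (t * x).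
Proof. by move=> ha p ht; rewrite (tensM _ _ ht ha) mul1r. Qed.

Lemma casimir_teleports T : teleports (@tswap k A T : AAT T -> AAT T) (casimir T).
Proof.
have sl := @tswap_linear k A T : linear (@tswap k A T : AAT T -> AAT T).
apply: teleports_pure => // p q a x ha.
rewrite /homog /= => <-.
elim/tens_homog_ind: x => [|x y IH1 IH2|q1 r a1 t ha1 ht].
- by rewrite thpart0 pure0r (linear_fun0 sl) mul0r mulr0 scaler0.
- by rewrite thpartD pureDr (linear_funD sl) mulrDl mulrDr IH1 IH2 scalerDr.
rewrite (thpartE _ ha1 ht); case: eqP => [->|_]; last first.
  by rewrite pure0r (linear_fun0 sl) mul0r mulr0 scaler0.
rewrite (tswapE _ ha ha1) -pzscalerAl.
(* Both products are brought to sums of values of [F] with the common twist [eps (+) p], the one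
   demanded by [casimir_mulr]. *)
pose F x y := pure x (pure y t) : AAT T.
have FB : bilinear_map F.
  split=> [z c x y|z c x y]; rewrite /F ?pureDl ?pureZl //.
  by rewrite pureDr pureZr.
have FB1 : bilinear_map (fun x y : A => F x (a * y)).
  by apply: bilin_comp (FB) _ _ => //; exact: mull_linear.
have FB2 : bilinear_map (fun x y : A => F x (y * a1)).
  by apply: bilin_comp (FB) _ _ => //; exact: mulr_linear.
have EL : (pure a1 (pure a t) : AAT T) * casimir T =
    psign (eps && r) *: \sum_l psign ((eps (+) p) && par l) *: F (a1 * b l) (a * bv l).
  rewrite mulr_sumr scaler_sumr; apply: eq_bigr => l _.
  rewrite -pzscalerAr (tensM _ _ (homog_pure ha ht) (frob_homog hA l)).
  rewrite (tensM _ _ ht (homog_dual_basis hA l)) pureZr mulr1 !scalerA -!psignD.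
  congr (psign _ *: _); by case: p (par l) r eps {ha ht} => [] [] [] [].
have ER : casimir T * pure a (pure a1 t) =
    psign (eps && p) *: \sum_l psign ((eps (+) p) && par l) *: F (b l * a) (bv l * a1).
  rewrite mulr_suml scaler_sumr; apply: eq_bigr => l _.
  rewrite -pzscalerAl (tensM _ _ (homog_pure (homog_dual_basis hA l) (homog1 T)) ha).
  rewrite (tensM _ _ (homog1 T) ha1) pureZr mul1r !scalerA -!psignD.
  congr (psign _ *: _); by case: p (par l) eps {ha EL} => [] [] [].
have EM : \sum_l psign ((eps (+) p) && par l) *: F (a1 * b l) (a * bv l)
    = psign ((eps (+) p) && q1)
      *: \sum_l psign ((eps (+) p) && par l) *: F (b l * a) (bv l * a1).
  (* First [a1] moves from the left of [b l] to the right of [bv l], then [a] from the left of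
     [bv l] to the right of [b l]. *)
  rewrite [LHS](casimir_mull hA FB1 _ ha1); congr (_ *: _).
  rewrite -[RHS](casimir_mulr hA FB2 ha).
  by apply: eq_bigr => l _; rewrite mulrA.
rewrite [X in _ *: X]EL [X in _ = _ *: X]ER EM !scalerA -!psignD.
by congr (psign _ *: _); case: p q1 r eps {ha ha1 ht EL ER EM FB1 FB2} => [] [] [] [].
Qed.

(** The sign of exchanging [b l] with [bv l], times the sign in [casimir], is [psign (par l)], which
    is the left side of [casimir_swap]. *)
Lemma tswap_casimir T : tswap (casimir T) = psign eps *: casimir T.
Proof.
have sl := @tswap_linear k A T : linear (@tswap k A T : AAT T -> AAT T).
pose F x y := pure x (pure y (1 : T)) : AAT T.
have FB : bilinear_map F.
  split=> [z c x y|z c x y]; rewrite /F ?pureDl ?pureZl //.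
  by rewrite pureDr pureZr.
rewrite -(casimir_swap hA FB) (linear_fun_sum sl); apply: eq_bigr => l _.
rewrite (linear_funZ sl) (tswapE _ (frob_homog hA l) (homog_dual_basis hA l)).
rewrite scalerA -psignD; congr (psign _ *: _).
by case: (par l) eps => [] [].
Qed.

Lemma tau_teleports i n : (i.+1 < n)%N -> teleports (@superperm k A i n) (tau n i).
Proof.
elim: n => // n IHn; rewrite ltnS leq_eqVlt => /orP[/eqP En|lt_in].
  case: n / En {IHn}; rewrite superperm_top tau_top; exact: casimir_teleports.
rewrite superperm_low ?ltn_eqF // tau_low //.
have lin : linear (@superperm k A i n) by exact: superperm_linear.
have idl : linear (@id A) by [].
apply: teleports_pure => [|p q a x ha hx]; first exact: tens_map_linear.
rewrite tens_mapE // (tens1M _ ha (tau_homog lt_in)).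
rewrite (tensM _ _ (super_hom_homog (superperm_super_hom A i n) hx) (homog1 A)).
rewrite andbF scale1r mulr1 (IHn lt_in _ _ hx) pureZr scalerA -psignD.
by congr (psign _ *: _); case: p q eps {ha hx} => [] [] [].
Qed.

Lemma superperm_tau i n : (i.+1 < n)%N ->
  superperm i (tau n i) = psign eps *: tau n i.
Proof.
elim: n => // n IHn; rewrite ltnS leq_eqVlt => /orP[/eqP En|lt_in].
  case: n / En {IHn}; rewrite superperm_top tau_top; exact: tswap_casimir.
rewrite superperm_low ?ltn_eqF // tau_low //.
have lin : linear (@superperm k A i n) by exact: superperm_linear.
by rewrite tens_mapE // IHn // pureZr.
Qed.

Lemma tau_family_homog i l j : homog
  (if j == i.+1 then par l else if j == i then par l (+) eps else false)
  (if j == i.+1 then b l else if j == i then bv l else 1).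
Proof.
case: (j == i.+1); first exact: (frob_homog hA l).
case: (j == i); [exact: (homog_dual_basis hA l) | exact: homog1].
Qed.

Lemma superperm_tau_far i j n : (i.+1 < j)%N || (j.+1 < i)%N -> (j.+1 < n)%N ->
  superperm j (tau n i) = tau n i.
Proof.
move=> ij jn; have lin : linear (@superperm k A j n) by exact: superperm_linear.
rewrite (linear_fun_sum lin); apply: eq_bigr => l _; rewrite (linear_funZ lin).
rewrite (superperm_pure (tau_family_homog i l) jn).
congr (_ *: _); rewrite [_ && _](_ : _ = false) ?scale1r; first last.
by do !case: eqP => //=; lia.
by apply: eq_pure_tpow => m _; do !case: eqP => //; lia.
Qed.

(** Both sides have [b l] in factor [i.+2], 1 in factor [i.+1] and [bv l] in factor [i]; no sign
    arises, since each exchange is with the even element 1. *)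
Lemma superperm_tau_braid i n : (i.+2 < n)%N ->
  superperm i (tau n i.+1) = superperm i.+1 (tau n i).
Proof.
move=> lt_in; have lin l : linear (@superperm k A l n) by exact: superperm_linear.
rewrite !(linear_fun_sum (lin _)).
apply: eq_bigr => l _; rewrite !(linear_funZ (lin _)).
rewrite (superperm_pure (tau_family_homog i l) lt_in).
rewrite (superperm_pure (tau_family_homog i.+1 l) (ltnW lt_in)).
congr (_ *: _); rewrite [X in psign X](_ : _ = false) ?scale1r;
  last by do !case: eqP => //=; lia.
rewrite [X in psign X](_ : _ = false) ?scale1r;
  last by do !case: eqP => //=; lia.
by apply: eq_pure_tpow => m _; do !case: eqP => //; lia.
Qed.

End Tau.

(** * Endomorphism algebras and upper triangular matrices *)

Section Endomorphisms.
Variables (k : comPzRingType) (V : lmodType k).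

Definition linear_pred : {pred V -> V} := fun f => `[< linear f >].

Lemma linear_pred_submod_closed : submod_closed linear_pred.
Proof.
split=> [|c f g /asboolP fl /asboolP gl]; apply/asboolP => d x y.
  by rewrite /= scaler0 addr0.
change (c *: f (d *: x + y) + g (d *: x + y) = d *: (c *: f x + g x) + (c *: f y + g y)).
rewrite fl gl !scalerDr !scalerA mulrC -!addrA.
by congr (_ + _); rewrite addrCA.
Qed.
HB.instance Definition _ :=
  GRing.isSubmodClosed.Build k (V -> V) linear_pred linear_pred_submod_closed.

(** Cutting endomorphisms out of the module of all functions lets them inherit its module
    structure. *)
Record endo := Endo { endo_fun :> V -> V; endo_linearb : endo_fun \in linear_pred }.
HB.instance Definition _ := [isSub for endo_fun].
HB.instance Definition _ := [Choice of endo by <:].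
HB.instance Definition _ := [SubChoice_isSubLmodule of endo by <:].

Lemma endo_linear (f : endo) : linear f.
Proof. by case: f => f /= /asboolP. Qed.
Lemma endoP (f g : endo) : f =1 g -> f = g.
Proof. by move=> fg; apply: val_inj; apply/funext. Qed.
Definition mk_endo (f : V -> V) (fl : linear f) : endo := Endo (introT (asboolP _) fl).

Definition endo_one : endo := @mk_endo id (fun _ _ _ => erefl).
Lemma comp_linear (f g : endo) : linear (f \o g).
Proof. by move=> c x y; rewrite /= !endo_linear. Qed.
Definition endo_mul (f g : endo) : endo := mk_endo (comp_linear f g).

Lemma endoD (f g : endo) v : (f + g) v = f v + g v. Proof. by []. Qed.
Lemma endoZ c (f : endo) v : (c *: f) v = c *: f v. Proof. by []. Qed.
Lemma endo0 v : (0 : endo) v = 0. Proof. by []. Qed.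

Lemma endo_mulA : associative endo_mul.
Proof. by move=> f g h; apply: endoP. Qed.
Lemma endo_mul1 : left_id endo_one endo_mul.
Proof. by move=> f; apply: endoP. Qed.
Lemma endo_1mul : right_id endo_one endo_mul.
Proof. by move=> f; apply: endoP. Qed.
Lemma endo_mulDl : left_distributive endo_mul +%R.
Proof. by move=> f g h; apply: endoP. Qed.
Lemma endo_mulDr : right_distributive endo_mul +%R.
Proof. by move=> f g h; apply: endoP => v; exact: (linear_funD (endo_linear f)). Qed.
Lemma endo_scaleAl c f g : c *: endo_mul f g = endo_mul (c *: f) g.
Proof. exact: endoP. Qed.
Lemma endo_scaleAr c f g : c *: endo_mul f g = endo_mul f (c *: g).
Proof. by apply: endoP => v; rewrite /= (linear_funZ (endo_linear f)). Qed.

Definition endo_alg : pzAlg k :=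
  PzAlg endo_mulA endo_mul1 endo_1mul endo_mulDl endo_mulDr endo_scaleAl endo_scaleAr.
End Endomorphisms.

Section Triangular.
Variables (k : comPzRingType) (P : pzAlg k).

(* (s, d, f) stands for the matrix [[s, d], [0, f]] *)
Let tri : lmodType k := (P * P * P)%type.
Definition tri_one : tri := (1, 0, 1).
Definition tri_mul (x y : tri) : tri :=
  (x.1.1 * y.1.1, x.1.1 * y.1.2 + x.1.2 * y.2, x.2 * y.2).

Lemma tri_mulA : associative tri_mul.
Proof. by move=> x y z; rewrite /tri_mul /= !mulrA mulrDr mulrDl !mulrA addrA. Qed.
Lemma tri_mul1 : left_id tri_one tri_mul.
Proof. by case=> [[s d] f]; rewrite /tri_mul /= !mul1r mul0r addr0. Qed.
Lemma tri_1mul : right_id tri_one tri_mul.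
Proof. by case=> [[s d] f]; rewrite /tri_mul /= !mulr1 mulr0 add0r. Qed.
Lemma tri_mulDl : left_distributive tri_mul +%R.
Proof. by move=> x y z; rewrite /tri_mul /= !mulrDl addrACA. Qed.
Lemma tri_mulDr : right_distributive tri_mul +%R.
Proof. by move=> x y z; rewrite /tri_mul /= !mulrDr addrACA. Qed.
Lemma tri_scaleAl c x y : c *: tri_mul x y = tri_mul (c *: x) y.
Proof. by rewrite /tri_mul /= -!pzscalerAl -scalerDr. Qed.
Lemma tri_scaleAr c x y : c *: tri_mul x y = tri_mul x (c *: y).
Proof. by rewrite /tri_mul /= -!pzscalerAr -scalerDr. Qed.

(** A morphism from [P] to [tri_alg P] with last entry the identity amounts to an endomorphism s
    together with an s-twisted derivation, so one use of the universal property constructs both. *)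
Definition tri_alg : pzAlg k :=
  PzAlg tri_mulA tri_mul1 tri_1mul tri_mulDl tri_mulDr tri_scaleAl tri_scaleAr.
End Triangular.

Section PresentationInd.
Variables (k : comPzRingType) (G : Type) (R : aexpr k G -> aexpr k G -> Prop).

Lemma pres_ind (Q : presAlg R -> Prop) :
  Q 0 -> Q 1 -> (forall g, Q (gen R g)) -> (forall x y, Q x -> Q y -> Q (x + y)) ->
  (forall c x, Q x -> Q (c *: x)) -> (forall x y, Q x -> Q y -> Q (x * y)) ->
  forall x, Q x.
Proof.
move=> Q0 Q1 Qg QD QZ QM; elim/pres_quotP => s; rewrite -aeval_gen.
elim: s => //= [s Qs t Qt|s Qs|c s Qs|s Qs t Qt].
- exact: QD.
- by rewrite -scaleN1r; exact: QZ.
- exact: QZ.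
- exact: QM.
Qed.
End PresentationInd.

(** * The action of nilHecke_n(A) *)

Section NilHeckeBasis.
Variables (k : comPzRingType) (A : superAlg k) (eps : bool).
Variables (tr : {linear A -> k^o}) (I : finType) (par : I -> bool) (b bv : I -> A).
Hypothesis hA : symmetric_frobenius eps tr par b bv.
Variable n : nat.

Local Notation P := (Pol A eps n).
Local Notation N := (nilCox k n).
Local Notation H := (nilHecke eps par b bv n).
Local Notation tau i := (tau eps par b bv n i).
Local Notation sgn := (psign eps : k).

Definition pol_a (a : tpow A n) : P := gen _ (PolA a).
Definition pol_x (m : 'I_n) : P := gen _ (PolX m).
Definition cox_u (i : 'I_n.-1) : N := gen _ i.

Lemma pol_aD a a' : pol_a (a + a') = pol_a a + pol_a a'.
Proof. exact: (pres_rel (pol_addA eps a a')). Qed.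
Lemma pol_aZ c a : pol_a (c *: a) = c *: pol_a a.
Proof. exact: (pres_rel (pol_scaleA eps c a)). Qed.
Lemma pol_aM a a' : pol_a (a * a') = pol_a a * pol_a a'.
Proof. exact: (pres_rel (pol_mulA eps a a')). Qed.
Lemma pol_a1 : pol_a 1 = 1.
Proof. exact: (pres_rel (pol_oneA A eps n)). Qed.
Lemma pol_xC i j : i != j -> pol_x i * pol_x j = sgn *: (pol_x j * pol_x i).
Proof. by move=> ij; exact: (pres_rel (pol_xx A eps ij)). Qed.
Lemma pol_axC p a i : homog p a ->
  pol_a a * pol_x i = psign (eps && p) *: (pol_x i * pol_a a).
Proof. by move=> ha; exact: (pres_rel (pol_ax eps i ha)). Qed.

(** * The twisted derivations of the polynomial algebra *)

Definition swap_nat (i m : nat) : nat :=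
  if m == i then i.+1 else if m == i.+1 then i else m.
Lemma swap_ord_subproof (i : 'I_n.-1) (m : 'I_n) : (swap_nat i m < n)%N.
Proof.
have := ltn_ord i; have := ltn_ord m; rewrite /swap_nat.
by do !case: eqP; lia.
Qed.
Definition swap_ord i m : 'I_n := Ordinal (swap_ord_subproof i m).

(* u_i x_m = x_{s_i m} u_i + dx i m tau_i *)
Definition dx (i m : nat) : k := if m == i then - sgn else if m == i.+1 then 1 else 0.

Lemma ord_pred_lt (i : 'I_n.-1) : (i.+1 < n)%N.
Proof. by have := ltn_ord i; lia. Qed.

Definition demazure_gen (i : 'I_n.-1) (g : pol_gen A n) : tri_alg P :=
  match g with
  | PolA a => (pol_a (superperm i a), 0, pol_a a)
  | PolX m => (pol_x (swap_ord i m), dx i m *: pol_a (tau i), pol_x m)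
  end.

Lemma triM (x y : tri_alg P) :
  x * y = (x.1.1 * y.1.1, x.1.1 * y.1.2 + x.1.2 * y.2, x.2 * y.2).
Proof. by []. Qed.

(** This relation between the two nonzero values of [dx] drives the cancellations in
    [demazure_gen_xx] and [demazure_endo_sq]. *)
Lemma dx_swap i m : dx i (swap_nat i m) = - sgn * dx i m.
Proof.
rewrite /dx /swap_nat.
case: (eqVneq m i) => [_|mi].
  by rewrite eqxx (gtn_eqF (ltnSn i)) mulrNN psignK.
case: (eqVneq m i.+1) => [_|mSi]; first by rewrite eqxx mulr1.
by rewrite (negbTE mi) (negbTE mSi) mulr0.
Qed.

Lemma dx_out (i : 'I_n.-1) (m : 'I_n) : m != i :> nat -> m != i.+1 :> nat ->
  dx i m = 0 /\ swap_ord i m = m.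
Proof.
move=> mi mSi; split; first by rewrite /dx (negbTE mi) (negbTE mSi).
by apply: val_inj; rewrite /= /swap_nat (negbTE mi) (negbTE mSi).
Qed.

Lemma swap_ordK i : involutive (swap_ord i).
Proof. by move=> m; apply: val_inj; rewrite /= /swap_nat; do !case: eqP; lia. Qed.

Lemma demazure_gen_xx i j l : j != l ->
  demazure_gen i (PolX j) * demazure_gen i (PolX l)
  = sgn *: (demazure_gen i (PolX l) * demazure_gen i (PolX j)).
Proof.
move=> jl.
have tx m : pol_a (tau i) * pol_x m = sgn *: (pol_x m * pol_a (tau i)).
  by rewrite (pol_axC _ (tau_homog hA (ord_pred_lt i))) andbb.
have sjl : swap_ord i j != swap_ord i l.
  apply: contra_neq jl => /(congr1 val) /= E; apply/val_inj; move: E.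
  by rewrite /swap_nat; do !case: eqP => //=; lia.
rewrite !triM; congr (_, _, _); [exact: pol_xC | | exact: pol_xC].
rewrite /= scalerDr -!pzscalerAr -!pzscalerAl !tx !scalerA.
rewrite (mulrC (dx i j)) (mulrC (dx i l)) mulrA psignK mul1r.
(* Only the off-diagonal entry is left. If [j] and [l] are [i] and [i.+1] in some order, both sides
   vanish by [dx_swap]; otherwise one of the two variables is fixed by s_i and killed by d_i. *)
have [El|nl] := eqVneq l (swap_ord i j).
  have Esl : swap_ord i l = j by rewrite El swap_ordK.
  have Edl : dx i l = - sgn * dx i j by rewrite El dx_swap.
  rewrite -El Esl Edl -!scalerDl.
  by rewrite mulNr addrC subrr !scale0r.
have [[-> ->]|[-> ->]] :
    (dx i j = 0 /\ swap_ord i j = j) \/ (dx i l = 0 /\ swap_ord i l = l).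
- have lj : l <> swap_nat i j :> nat by move=> E; case/eqP: nl; exact/val_inj.
  have jl' : j <> l :> nat by move=> E; case/eqP: jl; exact/val_inj.
  have [Ej|Ej] : (j != i :> nat) && (j != i.+1 :> nat)
      \/ (l != i :> nat) && (l != i.+1 :> nat).
    by move: lj jl'; rewrite /swap_nat; do !case: eqP => //=; lia.
  + by left; case/andP: Ej => /dx_out Ej /Ej.
  + by right; case/andP: Ej => /dx_out Ej /Ej.
- by rewrite mulr0 !scale0r addrC.
- by rewrite !scale0r addrC.
Qed.

Lemma demazure_rel i s t : pol_rel eps s t ->
  aeval (demazure_gen i) s = aeval (demazure_gen i) t.
Proof.
have sl : linear (@superperm k A i n) by exact: superperm_linear.
have [_ sM s1 sh] := superperm_super_hom A i n.
case=> {s t} [a a'|c a|a a'| |j l jl|p a m ha] /=.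
- by congr (_, _, _); rewrite /= ?(linear_funD sl) ?pol_aD ?addr0.
- by congr (_, _, _); rewrite /= ?(linear_funZ sl) ?pol_aZ ?scaler0.
- by rewrite triM; congr (_, _, _); rewrite /= ?sM ?pol_aM // mulr0 mul0r addr0.
- by congr (_, _, _); rewrite ?s1 pol_a1.
- exact: demazure_gen_xx.
- rewrite !triM; congr (_, _, _) => /=;
    [exact: (pol_axC _ (sh _ _ ha)) | | exact: pol_axC].
  (* The off-diagonal entry of the relation between [a] and [x] is exactly the teleportation
     identity for [tau i]. *)
  rewrite mulr0 add0r mul0r addr0 -pzscalerAr -pzscalerAl -!pol_aM.
  by rewrite (tau_teleports hA (ord_pred_lt i) ha) pol_aZ !scalerA mulrC.
Qed.

Definition demazure_tri i : P -> tri_alg P := pres_lift (demazure_gen i).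
Definition pol_s i (f : P) : P := (demazure_tri i f).1.1.
Definition demazure i (f : P) : P := (demazure_tri i f).1.2.

Lemma demazure_tri_linear i : linear (demazure_tri i).
Proof. exact: (pres_lift_linear (@demazure_rel i)). Qed.
Lemma demazure_triM i : {morph demazure_tri i : f g / f * g}.
Proof. exact: (pres_liftM (@demazure_rel i)). Qed.
Lemma demazure_tri1 i : demazure_tri i 1 = 1.
Proof. exact: (pres_lift1 (@demazure_rel i)). Qed.
Lemma demazure_triE i g : demazure_tri i (gen _ g) = demazure_gen i g.
Proof. exact: (pres_liftE (@demazure_rel i)). Qed.

(** This makes the off-diagonal entry of a product the twisted Leibniz rule, with [g] itself as the
    last factor. *)
Lemma demazure_tri_diag i f : (demazure_tri i f).2 = f.
Proof.
have tl := demazure_tri_linear i.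
elim/pres_ind: f => [||g|x y IHx IHy|c x IHx|x y IHx IHy].
- by rewrite (linear_fun0 tl).
- by rewrite demazure_tri1.
- by rewrite demazure_triE; case: g.
- by rewrite (linear_funD tl) /= IHx IHy.
- by rewrite (linear_funZ tl) /= IHx.
- by rewrite demazure_triM triM /= IHx IHy.
Qed.

Lemma pol_s_linear i : linear (pol_s i).
Proof. by move=> c f g; rewrite /pol_s demazure_tri_linear. Qed.
Lemma demazure_linear i : linear (demazure i).
Proof. by move=> c f g; rewrite /demazure demazure_tri_linear. Qed.
Lemma pol_sM i : {morph pol_s i : f g / f * g}.
Proof. by move=> f g; rewrite /pol_s demazure_triM. Qed.
Lemma demazureM i f g :
  demazure i (f * g) = pol_s i f * demazure i g + demazure i f * g.
Proof. by rewrite /demazure demazure_triM triM /= demazure_tri_diag. Qed.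
Lemma pol_s1 i : pol_s i 1 = 1.
Proof. by rewrite /pol_s demazure_tri1. Qed.
Lemma demazure1 i : demazure i 1 = 0.
Proof. by rewrite /demazure demazure_tri1. Qed.

(** * The operators on the tensor product and their nilCoxeter relations *)

Local Notation V := (tens P N).
Local Notation E := (endo_alg V).

Definition left_mul (f : P) : V -> V := tens_map (fun g : P => f * g : P) id.
Definition demazure_op (i : 'I_n.-1) (v : V) : V :=
  tens_map (pol_s i) (fun z : N => cox_u i * z : N) v + tens_map (demazure i) id v.

Lemma left_mulE f g z : left_mul f (pure g z) = pure (f * g : P) z.
Proof. by rewrite [LHS]tens_mapE //; exact: mull_linear. Qed.
Lemma demazure_opE i g z :
  demazure_op i (pure g z) = pure (pol_s i g) (cox_u i * z : N) + pure (demazure i g) z.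
Proof.
rewrite /demazure_op tens_mapE; try exact: mull_linear; try exact: pol_s_linear.
by rewrite tens_mapE //; exact: demazure_linear.
Qed.
Lemma left_mul_linear f : linear (left_mul f).
Proof. by apply: tens_map_linear => //; exact: mull_linear. Qed.
Lemma demazure_op_linear i : linear (demazure_op i).
Proof.
move=> c v w; rewrite /demazure_op.
have idl : linear (@id N) by [].
rewrite (tens_map_linear (@pol_s_linear i) (@mull_linear k N (cox_u i))).
rewrite (tens_map_linear (@demazure_linear i) idl).
by rewrite scalerDr addrACA.
Qed.

Definition left_mul_endo f : E := mk_endo (left_mul_linear f).
Definition demazure_endo i : E := mk_endo (demazure_op_linear i).
Local Notation L := left_mul_endo.
Local Notation U := demazure_endo.

Lemma endo_ext (W W' : E) : (forall f z, W (pure f z) = W' (pure f z)) -> W = W'.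
Proof.
by move=> WW'; apply: endoP; apply: tens_ext WW'; exact: endo_linear.
Qed.

Lemma left_mul_endo_linear : linear L.
Proof.
move=> c f g; apply: endo_ext => h z.
rewrite [RHS]endoD [X in _ = X + _]endoZ /= !left_mulE.
by rewrite mulrDl -pzscalerAl pureDl pureZl.
Qed.
Lemma left_mul_endoM : {morph L : f g / f * g}.
Proof. by move=> f g; apply: endo_ext => h z; rewrite /= !left_mulE mulrA. Qed.
Lemma left_mul_endo1 : L 1 = 1.
Proof. by apply: endo_ext => h z; rewrite /= left_mulE mul1r. Qed.

Lemma demazure_endoM i f : U i * L f = L (pol_s i f) * U i + L (demazure i f).
Proof.
apply: endo_ext => g z; rewrite [RHS]endoD /= !left_mulE !demazure_opE.
by rewrite (linear_funD (left_mul_linear _)) !left_mulE pol_sM demazureM pureDl addrA.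
Qed.

Local Notation T i := (L (pol_a (tau i))).
Local Notation X m := (L (pol_x m)).

Lemma demazure_endo_a i a : U i * L (pol_a a) = L (pol_a (superperm i a)) * U i.
Proof.
rewrite demazure_endoM /pol_s /demazure !demazure_triE /=.
by rewrite (linear_fun0 left_mul_endo_linear) addr0.
Qed.
Lemma demazure_endo_x i m :
  U i * X m = X (swap_ord i m) * U i + dx i m *: T i.
Proof.
rewrite demazure_endoM /pol_s /demazure !demazure_triE /=.
by rewrite (linear_funZ left_mul_endo_linear).
Qed.
(** On these vectors the nilCoxeter relations of the operators are inherited from those in [N]. *)
Lemma demazure_endo_1 i z : U i (pure (1 : P) z) = pure (1 : P) (cox_u i * z : N).
Proof. by rewrite /= demazure_opE pol_s1 demazure1 pure0l addr0. Qed.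

(* The f such that W v = 0 implies W (f v) = 0 form a subalgebra of P. *)
Lemma endo_eq0 (W : E) : (forall z, W (pure (1 : P) z) = 0) ->
  (forall a, exists Y, W * L (pol_a a) = Y * W) ->
  (forall m, exists Y, W * X m = Y * W) -> W = 0.
Proof.
move=> W1 Wa Wx; have Wl := endo_linear W.
have stable (f : P) (v : V) : W v = 0 -> W (left_mul f v) = 0.
  move=> Wv0; rewrite -[LHS]/((W * L f) v).
  elim/pres_ind: f v Wv0 => [||g|f g IHf IHg|c f IHf|f g IHf IHg] v Wv0.
  - by rewrite (linear_fun0 left_mul_endo_linear) mulr0.
  - by rewrite left_mul_endo1 mulr1.
  - have [Y WY] : exists Y, W * L (gen _ g) = Y * W.
      by case: g => [a|m]; [exact: Wa | exact: Wx].
    rewrite WY -[LHS]/(Y (W v)) Wv0.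
    exact: (linear_fun0 (endo_linear Y)).
  - by rewrite (linear_funD left_mul_endo_linear) mulrDr [LHS]endoD IHf // IHg // addr0.
  - by rewrite (linear_funZ left_mul_endo_linear) -pzscalerAr [LHS]endoZ IHf // scaler0.
  - by rewrite left_mul_endoM mulrA; apply: (IHf (left_mul g v)); exact: IHg.
apply: endo_ext => f z.
by rewrite -(mulr1 f) -left_mulE stable.
Qed.

(** Besides the leading term, moving [X m] to the left leaves remainders with a single [U]; these
    must cancel before [endo_eq0] can be applied. *)
Lemma demazure_endo2_x i j m : U i * U j * X m =
  X (swap_ord i (swap_ord j m)) * (U i * U j)
  + (dx i (swap_ord j m) *: (T i * U j)
     + dx j m *: (L (pol_a (superperm i (tau j))) * U i)).
Proof.
rewrite -mulrA demazure_endo_x mulrDr mulrA demazure_endo_x mulrDl -pzscalerAl -pzscalerAr.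
by rewrite demazure_endo_a -mulrA addrA.
Qed.

Lemma demazure_endo_sq i : U i * U i = 0.
Proof.
apply: endo_eq0 => [z|a|m].
- rewrite -[LHS]/(U i (U i (pure (1 : P) z))) !demazure_endo_1 mulrA.
  by rewrite (pres_rel (cox_sq k i) : cox_u i * cox_u i = 0) mul0r pure0r.
- by eexists; rewrite -mulrA demazure_endo_a mulrA demazure_endo_a -mulrA.
(* The superpermutation scales [tau i] by [sgn], and [dx_swap] then gives the two remainders
   opposite coefficients. *)
- eexists; rewrite demazure_endo2_x (superperm_tau hA (ord_pred_lt i)).
  rewrite pol_aZ (linear_funZ left_mul_endo_linear) -pzscalerAl scalerA -scalerDl.
  by rewrite dx_swap mulNr mulrC addNr scale0r addr0.
Qed.

Lemma demazure_endo_comm (i j : 'I_n.-1) : (i.+1 < j)%N || (j.+1 < i)%N ->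
  U i * U j = U j * U i.
Proof.
move=> ij; apply/eqP; rewrite -subr_eq0; apply/eqP.
have sC (a : tpow A n) : superperm i (superperm j a) = superperm j (superperm i a).
  by case/orP: ij => ij; [|symmetry]; exact: superperm_comm.
have ji : (j.+1 < i)%N || (i.+1 < j)%N by rewrite orbC.
have swC m : swap_ord i (swap_ord j m) = swap_ord j (swap_ord i m).
  by apply: val_inj; rewrite /= /swap_nat; do !case: eqP; lia.
have dxs (i1 j1 : 'I_n.-1) (m : 'I_n) : (i1.+1 < j1)%N || (j1.+1 < i1)%N ->
    dx i1 (swap_ord j1 m) = dx i1 m.
  by rewrite /dx /= /swap_nat => ij1; do !case: eqP => //; lia.
apply: endo_eq0 => [z|a|m].
- rewrite -[LHS]/(U i (U j (pure (1 : P) z)) - U j (U i (pure (1 : P) z))).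
  rewrite !demazure_endo_1 !mulrA.
  by rewrite (pres_rel (cox_comm k ij) : cox_u i * cox_u j = cox_u j * cox_u i) subrr.
- exists (L (pol_a (superperm i (superperm j a)))).
  rewrite mulrBl mulrBr -!mulrA !demazure_endo_a !mulrA !demazure_endo_a sC.
  by rewrite -!mulrA.
(* The distant superpermutation fixes each [tau], so both orders have the same two remainders,
   listed in opposite order. *)
- exists (X (swap_ord i (swap_ord j m))).
  rewrite mulrBl mulrBr !demazure_endo2_x swC !dxs //.
  rewrite !(superperm_tau_far hA) ?ord_pred_lt //.
  by rewrite [Z in _ - (_ + Z)]addrC opprD addrACA subrr addr0.
Qed.

Lemma demazure_endo2_a i j a : U i * U j * L (pol_a a)
  = L (pol_a (superperm i (superperm j a))) * (U i * U j).
Proof. by rewrite -mulrA demazure_endo_a mulrA demazure_endo_a -mulrA. Qed.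

(** Of the three remainders one contains [U i * U i] and vanishes by [demazure_endo_sq], which is
    why squares come first. *)
Lemma demazure_endo3_x i j m : U i * U j * U i * X m =
  X (swap_ord i (swap_ord j (swap_ord i m))) * (U i * U j * U i)
  + (dx i (swap_ord j (swap_ord i m)) *: (T i * (U j * U i))
     + dx i m *: (L (pol_a (superperm i (superperm j (tau i)))) * (U i * U j))).
Proof.
rewrite -mulrA demazure_endo_x mulrDr mulrA demazure_endo2_x !mulrDl -!pzscalerAl -pzscalerAr.
rewrite -(mulrA (L _) (U i) (U i)) demazure_endo_sq mulr0 scaler0 addr0.
by rewrite demazure_endo2_a -!mulrA -addrA.
Qed.

Lemma demazure_endo_braid (i j : 'I_n.-1) : j = i.+1 :> nat ->
  U i * U j * U i = U j * U i * U j.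
Proof.
move=> ij; apply/eqP; rewrite -subr_eq0; apply/eqP.
have lt_in : (i.+2 < n)%N by rewrite -ij ord_pred_lt.
have sB (a : tpow A n) : superperm i (superperm j (superperm i a))
    = superperm j (superperm i (superperm j a)).
  by rewrite ij; exact: superperm_braid.
have sT : superperm i (tau j) = superperm j (tau i).
  by rewrite ij; exact: (superperm_tau_braid hA lt_in).
have swB m : swap_ord i (swap_ord j (swap_ord i m))
      = swap_ord j (swap_ord i (swap_ord j m)).
  by apply: val_inj; rewrite /= /swap_nat; do !case: eqP; lia.
have dij (m : 'I_n) : dx i (swap_ord j (swap_ord i m)) = dx j m.
  by rewrite /dx /= /swap_nat; do !case: eqP => //; lia.
have dji (m : 'I_n) : dx j (swap_ord i (swap_ord j m)) = dx i m.
  by rewrite /dx /= /swap_nat; do !case: eqP => //; lia.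
apply: endo_eq0 => [z|a|m].
- rewrite -[LHS]/(U i (U j (U i (pure (1 : P) z))) - U j (U i (U j (pure (1 : P) z)))).
  rewrite !demazure_endo_1 !mulrA.
  rewrite (pres_rel (cox_braid k ij)
    : cox_u i * cox_u j * cox_u i = cox_u j * cox_u i * cox_u j).
  by rewrite subrr.
- exists (L (pol_a (superperm i (superperm j (superperm i a))))).
  have UUU i1 j1 : U i1 * U j1 * U i1 * L (pol_a a)
      = L (pol_a (superperm i1 (superperm j1 (superperm i1 a)))) * (U i1 * U j1 * U i1).
    by rewrite -mulrA demazure_endo_a mulrA demazure_endo2_a -mulrA.
  by rewrite mulrBl mulrBr !UUU sB.
(* By [sTi] and [sTj], both words leave one remainder with [tau i] and one with [tau j], in opposite
   order and with equal coefficients by [dij] and [dji]. *)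
- exists (X (swap_ord i (swap_ord j (swap_ord i m)))).
  have sTi : superperm i (superperm j (tau i)) = tau j by rewrite -sT superpermK.
  have sTj : superperm j (superperm i (tau j)) = tau i by rewrite sT superpermK.
  rewrite mulrBl mulrBr !demazure_endo3_x swB dij dji sTi sTj.
  by rewrite [Z in _ - (_ + Z)]addrC opprD addrACA subrr addr0.
Qed.

(** * The action and the inverse of the multiplication map *)

Local Notation nh := (gen (nh_rel eps par b bv (n := n))).
Local Notation pi := (@pol_to_nilHecke k A eps I par b bv n).
Local Notation nu := (@nilCox_to_nilHecke k A eps I par b bv n).

Definition nh_act_gen (g : nh_gen A n) : E :=
  match g with
  | NhA a => L (pol_a a)
  | NhX m => X m
  | NhU i => U i
  end.

Lemma nh_act_rel s t : nh_rel eps par b bv s t ->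
  aeval nh_act_gen s = aeval nh_act_gen t.
Proof.
have Ll := left_mul_endo_linear.
have swE (i : 'I_n.-1) (j j' : 'I_n) : j = i :> nat -> j' = i.+1 :> nat ->
    swap_ord i j = j' /\ swap_ord i j' = j.
  move=> ji j'i; split; apply: val_inj; rewrite /= /swap_nat ji j'i ?eqxx //.
  by case: eqP; lia.
case=> {s t} [a a'|c a|a a'| |i|i j ij|i j ij|i a
  |i j ij|p a i ha|i j ji jSi|i j j' ji j'i|i j j' ji j'i] /=.
- by rewrite pol_aD (linear_funD Ll).
- by rewrite pol_aZ (linear_funZ Ll).
- by rewrite pol_aM left_mul_endoM.
- by rewrite pol_a1 left_mul_endo1.
- exact: demazure_endo_sq.
- exact: demazure_endo_comm.
- exact: demazure_endo_braid.
- exact: demazure_endo_a.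
- by rewrite -!left_mul_endoM pol_xC // (linear_funZ Ll).
- by rewrite -!left_mul_endoM (pol_axC _ ha) (linear_funZ Ll).
- by have [d0 sj] := dx_out ji jSi; rewrite demazure_endo_x d0 sj scale0r addr0.
- have [_ sj] := swE _ _ _ ji j'i.
  by rewrite demazure_endo_x sj /dx j'i eqxx (gtn_eqF (ltnSn i)) scale1r.
(* This relation is [demazure_endo_x] at the index [i], where [dx] is [- sgn], with the [tau] term
   moved to the other side. *)
- have [sj _] := swE _ _ _ ji j'i.
  by rewrite demazure_endo_x sj /dx ji eqxx scaleNr addrNK.
Qed.

Definition nh_act : H -> E := pres_lift nh_act_gen.
Definition nh_to_tens (h : H) : V := nh_act h (pure (1 : P) (1 : N)).

Lemma nh_act_linear : linear nh_act.
Proof. exact: (pres_lift_linear nh_act_rel). Qed.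
Lemma nh_actM : {morph nh_act : x y / x * y}.
Proof. exact: (pres_liftM nh_act_rel). Qed.
Lemma nh_act1 : nh_act 1 = 1.
Proof. exact: (pres_lift1 nh_act_rel). Qed.
Lemma nh_actE g : nh_act (nh g) = nh_act_gen g.
Proof. exact: (pres_liftE nh_act_rel). Qed.

Lemma nh_act_pol f : nh_act (pi f) = L f.
Proof.
have Ll := left_mul_endo_linear; have pl : linear pi by exact: pol_to_nilHecke_linear.
elim/pres_ind: f => [||[a|m]|x y IHx IHy|c x IHx|x y IHx IHy].
- by rewrite (linear_fun0 pl) (linear_fun0 nh_act_linear) (linear_fun0 Ll).
- by rewrite pol_to_nilHecke1 nh_act1 left_mul_endo1.
- by rewrite pol_to_nilHeckeA nh_actE.
- by rewrite pol_to_nilHeckeX nh_actE.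
- by rewrite (linear_funD pl) (linear_funD nh_act_linear) IHx IHy (linear_funD Ll).
- by rewrite (linear_funZ pl) (linear_funZ nh_act_linear) IHx (linear_funZ Ll).
- by rewrite pol_to_nilHeckeM nh_actM IHx IHy left_mul_endoM.
Qed.

(** An arbitrary [z'] in place of 1 lets the induction on [z] pass through products. *)
Lemma nh_act_cox z z' : nh_act (nu z) (pure (1 : P) z') = pure (1 : P) (z * z' : N).
Proof.
have nl : linear nu by exact: nilCox_to_nilHecke_linear.
have al := nh_act_linear.
elim/pres_ind: z z' => [||i|x y IHx IHy|c x IHx|x y IHx IHy] z'.
- by rewrite (linear_fun0 nl) (linear_fun0 al) mul0r pure0r.
- by rewrite nilCox_to_nilHecke1 nh_act1 mul1r.
- by rewrite nilCox_to_nilHeckeU nh_actE demazure_endo_1.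
- by rewrite (linear_funD nl) (linear_funD al) [LHS]endoD IHx IHy mulrDl pureDr.
- by rewrite (linear_funZ nl) (linear_funZ al) [LHS]endoZ IHx -pzscalerAl pureZr.
- by rewrite nilCox_to_nilHeckeM nh_actM -mulrA -IHx -IHy.
Qed.

Lemma mult_mapK : cancel (mult_map eps par b bv n) nh_to_tens.
Proof.
have ml : linear (mult_map eps par b bv n) by move=> c x y; rewrite linearP.
have rl : linear nh_to_tens by move=> c x y; rewrite /nh_to_tens nh_act_linear.
move=> v; elim/tens_ind: v => [|x y IHx IHy|f z].
- by rewrite (linear_fun0 ml) (linear_fun0 rl).
- by rewrite (linear_funD ml) (linear_funD rl) IHx IHy.
rewrite mult_mapE /nh_to_tens nh_actM nh_act_pol.
rewrite -[LHS]/(left_mul f (nh_act (nu z) (pure (1 : P) (1 : N)))).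
by rewrite nh_act_cox left_mulE !mulr1.
Qed.

(** The rule imposed on the operators by [demazure_endoM] already holds in [H]: on generators it is
    a defining relation, and the twisted Leibniz rule carries it to products. *)
Lemma nh_demazure i f :
  nh (NhU i) * pi f = pi (pol_s i f) * nh (NhU i) + pi (demazure i f).
Proof.
have pl : linear pi by exact: pol_to_nilHecke_linear.
have sl := @pol_s_linear i; have dl := @demazure_linear i.
elim/pres_ind: f => [||g|x y IHx IHy|c x IHx|x y IHx IHy].
- by rewrite (linear_fun0 sl) (linear_fun0 dl) (linear_fun0 pl) mulr0 mul0r addr0.
- by rewrite pol_s1 demazure1 pol_to_nilHecke1 (linear_fun0 pl) mulr1 mul1r addr0.
- rewrite /pol_s /demazure !demazure_triE; case: g => [a|m] /=.
    rewrite (linear_fun0 pl) addr0 !pol_to_nilHeckeA.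
    exact: (pres_rel (nh_ua eps par b bv i a)).
  rewrite (linear_funZ pl) pol_to_nilHeckeA !pol_to_nilHeckeX.
  have [mi|mi] := eqVneq (m : nat) i.
    have Esm : swap_ord i m = i.+1 :> nat by rewrite /= /swap_nat mi eqxx.
    rewrite /dx mi eqxx scaleNr.
    by rewrite (pres_rel (nh_xu_succ eps par b bv mi Esm) : nh _ * nh _ = _) /= addrK.
  have [mSi|mSi] := eqVneq (m : nat) i.+1.
    have Esm : swap_ord i m = i :> nat.
      by rewrite /= /swap_nat mSi eqxx gtn_eqF.
    rewrite /dx mSi eqxx gtn_eqF // scale1r.
    exact: (pres_rel (nh_ux eps par b bv Esm mSi)).
  have [-> ->] := dx_out mi mSi; rewrite scale0r addr0.
  exact/esym/(pres_rel (nh_xu eps par b bv mi mSi)).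
- rewrite (linear_funD sl) (linear_funD dl) !(linear_funD pl).
  by rewrite mulrDr mulrDl IHx IHy addrACA.
- rewrite (linear_funZ sl) (linear_funZ dl) !(linear_funZ pl).
  by rewrite -pzscalerAr -pzscalerAl IHx scalerDr.
- rewrite pol_sM demazureM (linear_funD pl) !pol_to_nilHeckeM mulrA IHx mulrDl.
  by rewrite -[in LHS]mulrA IHy mulrDr !mulrA addrA.
Qed.

(** Equivariance gives the second inverse law: the vector [pure 1 1] is sent to 1, so its image
    under [h] is sent to [h]. *)
Lemma mult_map_act h v : mult_map eps par b bv n (nh_act h v)
  = h * mult_map eps par b bv n v.
Proof.
have ml : linear (mult_map eps par b bv n) by move=> c x y; rewrite linearP.
have pl : linear pi by exact: pol_to_nilHecke_linear.
have al := nh_act_linear.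
elim/pres_ind: h v => [||g|x y IHx IHy|c x IHx|x y IHx IHy] v.
- by rewrite (linear_fun0 al) [_ v]endo0 (linear_fun0 ml) mul0r.
- by rewrite nh_act1 mul1r.
- rewrite nh_actE.
  elim/tens_ind: v => [|v w IHv IHw|f z].
  + by rewrite (linear_fun0 (endo_linear _)) (linear_fun0 ml) mulr0.
  + by rewrite (linear_funD (endo_linear _)) !(linear_funD ml) IHv IHw mulrDr.
  rewrite mult_mapE; case: g => [a|m|i] /=.
  + by rewrite left_mulE mult_mapE pol_to_nilHeckeM pol_to_nilHeckeA mulrA.
  + by rewrite left_mulE mult_mapE pol_to_nilHeckeM pol_to_nilHeckeX mulrA.
  + rewrite demazure_opE (linear_funD ml) !mult_mapE nilCox_to_nilHeckeM.
    by rewrite nilCox_to_nilHeckeU !mulrA -mulrDl -nh_demazure.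
- by rewrite (linear_funD al) [_ v]endoD (linear_funD ml) IHx IHy mulrDl.
- by rewrite (linear_funZ al) [_ v]endoZ (linear_funZ ml) IHx pzscalerAl.
- by rewrite nh_actM -mulrA -IHy -IHx.
Qed.

Lemma nh_to_tensK : cancel nh_to_tens (mult_map eps par b bv n).
Proof.
move=> h; rewrite /nh_to_tens mult_map_act mult_mapE.
by rewrite pol_to_nilHecke1 nilCox_to_nilHecke1 !mulr1.
Qed.

End NilHeckeBasis.

Theorem theorem6p4 (k : comPzRingType) (A : superAlg k) (eps : bool)
    (tr : {linear A -> k^o}) (I : finType) (par : I -> bool) (b bv : I -> A)
    (hA : symmetric_frobenius eps tr par b bv) (n : nat) :
  bijective (mult_map eps par b bv n).
Proof. exact: Bijective (mult_mapK hA (n := n)) (nh_to_tensK hA (n := n)). Qed.
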